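(* Let $\tau$ be a vocabulary consisting of one binary relation symbol and a countably infinite set of unary relation symbols. Then both the satisfiability problem and the finite satisfiability problem of $\exists^3\forall[A_{\mathit{5\text{-}inc}}](\tau)$ are undecidable.
   Context: Team semantics (lax): structures have nonempty domains; an assignment is $s:D\to A$, $D$ a finite set of variables; a team $X$ is a set of assignments with common domain and codomain $A$; $\mathrm{rel}(X,(y_1,\dots,y_m))=\{(s(y_1),\dots,s(y_m)):s\in X\}$. Formulas in negation normal form (literals, $\wedge,\vee,\exists,\forall$) plus generalized atoms; literal holds in $X$ iff all $s\in X$ satisfy it; $\wedge$ componentwise; $\psi\vee\vartheta$ holds in $X$ iff $X=Y\cup Z$, $Y\models\psi$, $Z\models\vartheta$; $\exists x\psi$ holds in $X$ iff $\psi$ holds in $\{s[a/x]:s\in X,a\in F(s)\}$ for some $F:X\to\mathcal P(A)\setminus\{\emptyset\}$; $\forall x\psi$ holds in $X$ iff $\psi$ holds in $\{s[a/x]:s\in X,a\in A\}$; a sentence is true in $\mathfrak A$ iff it holds in $\{\emptyset\}$. $A_{\mathit{5\text{-}inc}}$ is the generalized atom of type $(5,5)$ with $\mathfrak A\models_X A_{\mathit{5\text{-}inc}}(\bar y,\bar z)$ iff $\mathrm{rel}(X,\bar y)\subseteq\mathrm{rel}(X,\bar z)$ (the 5-ary inclusion atom). $\exists^3\forall[A_{\mathit{5\text{-}inc}}](\tau)$: sentences over $\tau$ of the form $\exists x_1\exists x_2\exists x_3\forall y\,\theta$ with $\theta$ quantifier-free, possibly containing $A_{\mathit{5\text{-}inc}}$-atoms.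 (Finite) satisfiability: decide whether a given sentence has a (finite) model. *)

(* Defs.v *)
From mathcomp Require Import all_boot finmap.
From mathcomp Require Import boolp classical_sets cardinality.

Set Implicit Arguments.
Unset Strict Implicit.
Unset Printing Implicit Defensive.

Local Open Scope classical_set_scope.
Local Open Scope fmap_scope.

Record vocabulary := Vocabulary { sym :> Type; arity : sym -> nat }.

Record structure (tau : vocabulary) := Structure {
  dom :> Type;
  dom_nonempty : inhabited dom;
  interp : forall R : tau, (arity R).-tuple dom -> Prop }.

Definition var := nat.

Inductive formula (tau : vocabulary) : Type :=
| Eq of var & var
| Neq of var & var
| Rel (R : tau) of (arity R).-tuple var
| NRel (R : tau) of (arity R).-tuple var
| Inc5 of 5.-tuple var & 5.-tuple var
| And of formula tau & formula tau
| Or of formula tau & formula tau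
| Ex of var & formula tau
| All of var & formula tau.

Arguments Eq {tau} _ _.
Arguments Neq {tau} _ _.
Arguments Inc5 {tau} _ _.

Fixpoint quantifier_free (tau : vocabulary) (phi : formula tau) : bool :=
  match phi with
  | And psi theta | Or psi theta => quantifier_free psi && quantifier_free theta
  | Ex _ _ | All _ _ => false
  | _ => true
  end.

Fixpoint free_vars (tau : vocabulary) (phi : formula tau) : seq var :=
  match phi with
  | Eq x y | Neq x y => [:: x; y]
  | Rel _ xs | NRel _ xs => xs
  | Inc5 ys zs => ys ++ zs
  | And psi theta | Or psi theta => free_vars psi ++ free_vars theta
  | Ex x psi | All x psi => [seq z <- free_vars psi | z != x]
  end.

Definition sentence (tau : vocabulary) (phi : formula tau) : Prop :=
  free_vars phi = [::].

Definition E3A_sentence (tau : vocabulary) (phi : formula tau) : Prop :=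
  sentence phi /\
  exists (x1 x2 x3 y : var) (theta : formula tau),
    [/\ uniq [:: x1; x2; x3; y], quantifier_free theta &
        phi = Ex x1 (Ex x2 (Ex x3 (All y theta)))].

(* An assignment is a function from a finite set of variables to A.  The sets
   of assignments reached when evaluating a formula from {emptyset} always have
   a common domain, so this condition on teams is not recorded in the type. *)
Definition assignment (A : Type) := {fmap var -> A}.
Definition team (A : Type) := set (assignment A).

Definition values (A : Type) (s : assignment A) (m : nat)
    (ys : m.-tuple var) (a : m.-tuple A) : Prop :=
  forall i : 'I_m, s.[? tnth ys i] = Some (tnth a i).

Definition rel_of (A : Type) (X : team A) (m : nat) (ys : m.-tuple var) :
    set (m.-tuple A) :=
  [set a | exists2 s, X s & values s ys a].

Definition supplement (A : Type) (X : team A) (F : assignment A -> set A)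
    (x : var) : team A :=
  [set t | exists s a, [/\ X s, F s a & t = s.[x <- a]]].

Fixpoint holds (tau : vocabulary) (M : structure tau) (X : team M)
    (phi : formula tau) : Prop :=
  match phi with
  | Eq x y => forall s, X s ->
      exists a b : M, [/\ s.[? x] = Some a, s.[? y] = Some b & a = b]
  | Neq x y => forall s, X s ->
      exists a b : M, [/\ s.[? x] = Some a, s.[? y] = Some b & a <> b]
  | Rel R xs => forall s, X s -> exists2 a, values s xs a & interp a
  | NRel R xs => forall s, X s -> exists2 a, values s xs a & ~ interp a
  | Inc5 ys zs => rel_of X ys `<=` rel_of X zs
  | And psi theta => holds X psi /\ holds X theta
  | Or psi theta => exists Y Z : team M,
      [/\ X = Y `|` Z, holds Y psi & holds Z theta]
  | Ex x psi => exists F : assignment M -> set M,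
      (forall s, X s -> F s !=set0) /\ holds (supplement X F x) psi
  | All x psi => holds (supplement X (fun=> setT) x) psi
  end.

Definition true_in (tau : vocabulary) (M : structure tau) (phi : formula tau) :
    Prop :=
  holds [set [fmap] : assignment M] phi.

Definition satisfiable (tau : vocabulary) (phi : formula tau) : Prop :=
  exists M : structure tau, true_in M phi.

Definition finitely_satisfiable (tau : vocabulary) (phi : formula tau) : Prop :=
  exists M : structure tau, finite_set [set: M] /\ true_in M phi.

Inductive tau_sym := Bin | Un of nat.

Definition tau_bin_un : vocabulary :=
  Vocabulary (fun R : tau_sym => if R is Bin then 2 else 1).

(* Partial recursive functions, with their arities; [sem f v r] means that f is
   defined at v, with value r. *)
Inductive recf : nat -> Type :=
| Zero n : recf n
| Succ : recf 1
| Proj n of 'I_n : recf n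
| Comp n m of recf m & ('I_m -> recf n) : recf n
| PrimRec n of recf n & recf n.+2 : recf n.+1
| Mu n of recf n.+1 : recf n.

Fixpoint sem (n : nat) (f : recf n) : n.-tuple nat -> nat -> Prop :=
  match f in recf n return n.-tuple nat -> nat -> Prop with
  | Zero _ => fun _ r => r = 0
  | Succ => fun v r => r = (thead v).+1
  | Proj _ i => fun v r => r = tnth v i
  | @Comp _ m f g => fun v r =>
      exists2 w : m.-tuple nat, (forall i, sem (g i) v (tnth w i)) & sem f w r
  | @PrimRec n f g => fun v r =>
      let p : n.-tuple nat := [tuple of behead v] in
      (fix iter k r := match k with
        | 0 => sem f p r
        | k.+1 => exists2 q, iter k q & sem g [tuple of k :: q :: p] r
        end) (thead v) r
  | Mu _ f => fun v r =>
      sem f [tuple of r :: v] 0 /\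
      forall k, k < r -> exists q, sem f [tuple of k :: v] q.+1
  end.

(* The decision problem "given x in D, does P x hold?", for inputs presented
   through the numbering enc. *)
Definition decidable_problem (T : Type) (enc : T -> nat) (D P : T -> Prop) :
    Prop :=
  exists f : recf 1, forall x, D x ->
    (P x /\ sem f [tuple enc x] 1) \/ (~ P x /\ sem f [tuple enc x] 0).

Definition sym_code (R : tau_sym) : nat := if R is Un i then i.+1 else 0.

(* CodeSeq.code is a bijection from finite sequences of naturals to naturals. *)
Fixpoint formula_code (phi : formula tau_bin_un) : nat :=
  match phi with
  | Eq x y => CodeSeq.code [:: 0; x; y]
  | Neq x y => CodeSeq.code [:: 1; x; y]
  | Rel R xs => CodeSeq.code [:: 2, sym_code R & xs]
  | NRel R xs => CodeSeq.code [:: 3, sym_code R & xs]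
  | Inc5 ys zs => CodeSeq.code (4 :: ys ++ zs)
  | And psi theta => CodeSeq.code [:: 5; formula_code psi; formula_code theta]
  | Or psi theta => CodeSeq.code [:: 6; formula_code psi; formula_code theta]
  | Ex x psi => CodeSeq.code [:: 7; x; formula_code psi]
  | All x psi => CodeSeq.code [:: 8; x; formula_code psi]
  end.

Lemma sym_code_inj : injective sym_code.
Proof. by move=> [|i] [|j] //= [->]. Qed.

Lemma formula_code_inj : injective formula_code.
Proof.
elim=> [x y|x y|R xs|R xs|ys zs|a IHa b IHb|a IHa b IHb|x a IHa|x a IHa]
  [x' y'|x' y'|R' xs'|R' xs'|ys' zs'|a' b'|a' b'|x' a'|x' a'] eq_code;
  have := can_inj CodeSeq.codeK eq_code => {eq_code} // -[].
- by move=> -> ->.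
- by move=> -> ->.
- by move=> /sym_code_inj eqR; case: _ / eqR xs' => xs' /val_inj ->.
- by move=> /sym_code_inj eqR; case: _ / eqR xs' => xs' /val_inj ->.
- move=> /eqP; rewrite eqseq_cat ?size_tuple // => /andP[/eqP eqy /eqP eqz].
  by rewrite (val_inj eqy) (val_inj eqz).
- by move=> /IHa -> /IHb ->.
- by move=> /IHa -> /IHb ->.
- by move=> -> /IHa ->.
- by move=> -> /IHa ->.
Qed.

(* Main.v *)
From HB Require Import structures.
Require Import Defs.
From mathcomp Require Import all_boot finmap zify.
From mathcomp Require Import boolp classical_sets cardinality.

(** A history machine repeatedly appends a node to its own history.  A node
    carries a program counter, a tag, its predecessor and a pointer to an older
    node; the new pointer is obtained from the last node by at most two
    dereferences.  Reading the last node with tag x.+1 as an assignment to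
    register x, and a node as the length of its chain of pointers, such a machine
    simulates register programs, hence all partial recursive functions.

    A history is a structure over one binary and finitely many unary symbols:
    u is the pointer of v when the edge from u to v is not symmetric, and the
    predecessor of v when it is symmetric and the lengths modulo 3 fit.  In the
    team of a sentence Ex 0 Ex 1 Ex 2 All 3, variable 0 is a node, 1 its
    pointer, 2 the next node or the first one, so that the inclusion atom from 2
    to 0 makes every model contain the whole run.  If the run ends in the state
    "bad" there is no model, and if it ends in the state "good" the history is a
    finite model.

    Only the input has to be compiled computably: if e is the code of the
    formula describing a program for "run the supposed decider on the sentence
    obtained from the formula coded by e and the input e", then the decider is
    wrong on the sentence obtained from e. *)

Set Implicit Arguments.
Unset Strict Implicit.
Unset Printing Implicit Defensive.

Local Open Scope classical_set_scope.
Local Open Scope fmap_scope.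

(** * Teams of assignments to four variables *)

Section FourVariables.
Variables (tau : vocabulary) (M : structure tau).

Definition env : Type := (M * M * M * M)%type.

(** Every variable above 2 is sent to the last component; statements linking [val4] to [asg]
    therefore assume variables below 4. *)
Definition val4 (e : env) (x : var) : M :=
  let: (a, b, c, d) := e in
  match x with 0 => a | 1 => b | 2 => c | _ => d end.

Definition asg (e : env) : assignment M :=
  let: (a, b, c, d) := e in [fmap].[0 <- a].[1 <- b].[2 <- c].[3 <- d].

Lemma asgE e x : x < 4 -> (asg e).[? x] = Some (val4 e x).
Proof. by case: e => [[[a b] c] d]; move: x => [|[|[|[|]]]] //= _; rewrite !fnd_set. Qed.

Lemma asg_inj : injective asg.
Proof.
move=> e e' E; have {}E x : x < 4 -> val4 e x = val4 e' x.
  by move=> lx; have := asgE e lx; rewrite E asgE // => -[].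
case: e e' E => [[[a b] c] d] [[[a' b'] c'] d'] E.
by rewrite (E 0 isT : a = a') (E 1 isT : b = b') (E 2 isT : c = c') (E 3 isT : d = d').
Qed.

Definition env_team (Q : env -> Prop) : team M := [set s | exists2 e, Q e & s = asg e].

Lemma values_asg e n (ys : n.-tuple var) a :
  all (gtn 4) ys -> values (asg e) ys a <-> a = map_tuple (val4 e) ys.
Proof.
move=> /allP ly; have {}ly i : tnth ys i < 4 by apply: ly; apply: mem_tnth.
split=> [v|-> i]; last by rewrite asgE // tnth_map.
by apply: eq_from_tnth => i; rewrite tnth_map; have := v i; rewrite asgE // => -[].
Qed.

Fixpoint flat (phi : formula tau) : bool :=
  match phi with
  | And a b | Or a b => flat a && flat b
  | Inc5 _ _ | Ex _ _ | All _ _ => false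
  | _ => true
  end.

Fixpoint eval (e : env) (phi : formula tau) : Prop :=
  match phi with
  | Eq x y => val4 e x = val4 e y
  | Neq x y => val4 e x <> val4 e y
  | Rel R xs => interp (map_tuple (val4 e) xs)
  | NRel R xs => ~ interp (map_tuple (val4 e) xs)
  | And a b => eval e a /\ eval e b
  | Or a b => eval e a \/ eval e b
  | _ => True
  end.

Lemma holds_and (X : team M) (a b : formula tau) :
  holds X (And a b) <-> holds X a /\ holds X b.
Proof. by []. Qed.

(** Since [asg] is injective, every part of a team of this form is again the team of a predicate on
    [env]. *)
Lemma holds_or Q a b :
  holds (env_team Q) (Or a b) <->
  exists Q1 Q2 : env -> Prop, [/\ forall e, Q e <-> Q1 e \/ Q2 e,
    holds (env_team Q1) a & holds (env_team Q2) b].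
Proof.
split=> [[Y [Z [E ha hb]]]|[Q1 [Q2 [E ha hb]]]].
  exists (fun e => Y (asg e)), (fun e => Z (asg e)); split.
  - move=> e; have -> : Y (asg e) \/ Z (asg e) <-> env_team Q (asg e) by rewrite E.
    by split=> [q|[e' q /asg_inj ->]//]; exists e.
  - suff <- : Y = env_team (fun e => Y (asg e)) by [].
    apply/seteqP; split=> s; last by case=> e ? ->.
    move=> Ys; have [e q es] : env_team Q s by rewrite E; left.
    by exists e; rewrite // -es.
  - suff <- : Z = env_team (fun e => Z (asg e)) by [].
    apply/seteqP; split=> s; last by case=> e ? ->.
    move=> Zs; have [e q es] : env_team Q s by rewrite E; right.
    by exists e; rewrite // -es.
exists (env_team Q1), (env_team Q2); split=> //.
apply/seteqP; split=> s.
  by case=> e /E[] q ->; [left|right]; exists e.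
by case=> -[e q ->]; exists e => //; apply/E; [left|right].
Qed.

Lemma holds_inc Q (ys zs : 5.-tuple var) :
  all (gtn 4) ys -> all (gtn 4) zs ->
  holds (env_team Q) (Inc5 ys zs) <->
  forall e, Q e -> exists2 e', Q e' & map (val4 e) ys = map (val4 e') zs.
Proof.
move=> ly lz; split=> [h e q|h a [s [e q ->]]].
  have [|s [e' q' ->]] := h (map_tuple (val4 e) ys).
    by exists (asg e); [exists e|apply/values_asg].
  by move=> /(values_asg _ _ lz)/(congr1 val) /= E; exists e'.
move=> /(values_asg _ _ ly) ->; have [e' q' E] := h e q.
by exists (asg e'); [exists e'|apply/values_asg => //; apply: val_inj].
Qed.

(** Literals and conjunctions are checked assignment by assignment; for a disjunction the team
    splits into the assignments satisfying either disjunct. This is the flatness property of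
    first-order formulas. *)
Lemma holds_flat phi Q : flat phi -> all (gtn 4) (free_vars phi) ->
  holds (env_team Q) phi <-> forall e, Q e -> eval e phi.
Proof.
elim: phi Q => //=.
- move=> x y Q _ /and3P[lx ly _]; split=> [h e q|h s [e q ->]].
    have [|a [b []]] := h (asg e); first by exists e.
    by rewrite !asgE // => -[->] [->].
  by exists (val4 e x), (val4 e y); rewrite !asgE //; split=> //; apply: h.
- move=> x y Q _ /and3P[lx ly _]; split=> [h e q|h s [e q ->]].
    have [|a [b []]] := h (asg e); first by exists e.
    by rewrite !asgE // => -[->] [->].
  by exists (val4 e x), (val4 e y); rewrite !asgE //; split=> //; apply: h.
- move=> R xs Q _ lx; split=> [h e q|h s [e q ->]].
    by have [|a /(values_asg _ _ lx) ->] := h (asg e); first by exists e.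
  by exists (map_tuple (val4 e) xs); [apply/values_asg|apply: h].
- move=> R xs Q _ lx; split=> [h e q|h s [e q ->]].
    by have [|a /(values_asg _ _ lx) ->] := h (asg e); first by exists e.
  by exists (map_tuple (val4 e) xs); [apply/values_asg|apply: h].
- move=> a IHa b IHb Q /andP[fa fb]; rewrite all_cat => /andP[la lb].
  rewrite IHa // IHb //; split=> [[h1 h2] e q|h]; first by split; auto.
  by split=> e /h[].
- move=> a IHa b IHb Q /andP[fa fb]; rewrite all_cat => /andP[la lb].
  split=> [/holds_or[Q1 [Q2 [E h1 h2]]] e|h].
    move: h1 h2; rewrite IHa // IHb // => h1 h2 /E[].
  + by move=> /h1 ?; left; auto.
  + by move=> /h2 ?; right; auto.
  apply/holds_or; exists (fun e => Q e /\ eval e a), (fun e => Q e /\ eval e b).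
  split; [|by rewrite IHa // => e []|by rewrite IHb // => e []].
  by move=> e; split=> [q|[[]|[]]//]; case: (h e q); auto.
Qed.

Definition prefixed (theta : formula tau) := Ex 0 (Ex 1 (Ex 2 (All 3 theta))).

(** In lax semantics a supplementing function may choose several values at once, so three nested
    existential quantifiers select an arbitrary nonempty ternary relation. *)
Lemma true_prefixed theta :
  true_in M (prefixed theta) <->
  exists T : M -> M -> M -> Prop, (exists a b c, T a b c) /\
    holds (env_team (fun e => T (val4 e 0) (val4 e 1) (val4 e 2))) theta.
Proof.
rewrite /true_in /prefixed; split.
  move=> [F1 [n1 [F2 [n2 [F3 [n3 h]]]]]].
  pose s1 a : assignment M := [fmap].[0 <- a].
  pose s2 a b := (s1 a).[1 <- b].
  exists (fun a b c => [/\ F1 [fmap] a, F2 (s1 a) b & F3 (s2 a b) c]); split.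
    have [a Fa] := n1 _ erefl.
    have t1 : supplement [set [fmap]] F1 0 (s1 a) by exists [fmap], a.
    have [b Fb] := n2 _ t1.
    have t2 : supplement (supplement [set [fmap]] F1 0) F2 1 (s2 a b) by exists (s1 a), b.
    by have [c Fc] := n3 _ t2; exists a, b, c.
  move: h; congr (holds _ theta); apply/seteqP; split=> s.
    move=> [_ [d [[_ [c [[_ [b [[_ [a [-> Fa ->]]] Fb ->]]] Fc ->]]] _ ->]]].
    by exists (a, b, c, d).
  move=> [[[[a b] c] d] /= [Fa Fb Fc] ->].
  exists (s2 a b).[2 <- c], d; split=> //; exists (s2 a b), c; split=> //.
  by exists (s1 a), b; split=> //; exists [fmap], a.
move=> [T [[a0 [b0 [c0 T0]]] h]].
(* The choice sets are projections of [T], restricted by the values that the assignment already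
   gives to 0 and 1. *)
exists (fun _ a => exists b c, T a b c); split.
  by move=> s _; exists a0, b0, c0.
exists (fun (s : assignment M) b => exists a c, s.[? 0] = Some a /\ T a b c); split.
  move=> s [s' [a [_ [b [c Tabc]] ->]]].
  by exists b, a, c; rewrite fnd_set.
exists (fun (s : assignment M) c =>
  exists a b, [/\ s.[? 0] = Some a, s.[? 1] = Some b & T a b c]); split.
  move=> s [s1 [b [[s' [a [_ [b1 [c1 _]] ->]] [a' [c [] Ea Tabc ->]]]]]].
  move: Ea; rewrite fnd_set /= => -[Ea].
  by exists c, a', b; rewrite !fnd_set /= Ea.
move: h; congr (holds _ theta); apply/seteqP; split=> s.
  move=> [[[[a b] c] d] /= Tabc ->].
  exists [fmap].[0 <- a].[1 <- b].[2 <- c], d; split=> //.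
  exists [fmap].[0 <- a].[1 <- b], c; split=> //; last first.
    by exists a, b; rewrite !fnd_set.
  exists [fmap].[0 <- a], b; split=> //; last by exists a, c; rewrite fnd_set.
  by exists [fmap], a; split=> //; exists b, c.
move=> [_ [d [[_ [c [[_ [b [[_ [a [-> _ ->]]] _ ->]]] [a' [b' [Ea Eb Tabc]]] ->]]] _ ->]]].
exists (a, b, c, d) => //=.
by move: Ea Eb; rewrite !fnd_set /= => -[->] [->].
Qed.

(** The last branch is a default value for inclusion atoms and quantifiers; [eval_neg] speaks of
    flat formulas only. *)
Fixpoint neg (phi : formula tau) : formula tau :=
  match phi with
  | Eq x y => Neq x y
  | Neq x y => Eq x y
  | Rel R xs => NRel xs
  | NRel R xs => Rel xs
  | And a b => Or (neg a) (neg b)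
  | Or a b => And (neg a) (neg b)
  | phi => phi
  end.

Lemma eval_neg e phi : flat phi -> eval e (neg phi) <-> ~ eval e phi.
Proof.
elim: phi => //= [x y _|R xs _|a IHa b IHb /andP[fa fb]|a IHa b IHb /andP[fa fb]].
- by split=> [-> //|/contrapT].
- by split=> [? []//|/contrapT].
- by rewrite IHa // IHb // -not_andE.
- by rewrite IHa // IHb // -not_orE.
Qed.

End FourVariables.

(** * History machines and their formulas *)

Inductive tree := Leaf of bool | Node of nat & nat & tree & tree.

HB.instance Definition _ := gen_eqMixin tree.
HB.instance Definition _ := gen_choiceMixin tree.

(** Tags are shifted by one so that 0 marks exactly the leaves, which gives the zero test of the
    register simulation. *)
Definition root_tag (t : tree) : nat := if t is Node _ d _ _ then d.+1 else 0.

Inductive move := Stay | PrevOfPtr | PtrOfPtr | Recall.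

Definition move_ptr (m : move) (p c : tree) : option tree :=
  match m, c with
  | Stay, _ => Some c
  | Recall, _ => Some p
  | PrevOfPtr, Node _ _ p' _ => Some p'
  | PtrOfPtr, Node _ _ _ c' => Some c'
  | _, Leaf _ => None
  end.

Record action := Action { written : nat; mov : move; goto : nat }.
Record instr := Instr { tested : nat; act_eq : action; act_neq : action }.

Definition jump (A : action) := Instr 0 A A.

Definition act (i : instr) (c : tree) : action :=
  if root_tag c == tested i then act_eq i else act_neq i.

(** Two different leaves are used so that predecessor and pointer of the first node differ, as
    [sane] demands. Program counter 1 begins the input phase. *)
Definition start_tree := Node 1 0 (Leaf true) (Leaf false).

Section Machine.
Variables (pcs : seq nat) (code : nat -> instr).

Inductive step : tree -> tree -> Prop :=
| Step a d p c c' : a \in pcs -> move_ptr (mov (act (code a) c)) p c = Some c' ->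
    step (Node a d p c)
         (Node (goto (act (code a) c)) (written (act (code a) c)) (Node a d p c) c').

Inductive run (t : tree) : tree -> Prop :=
| run_refl : run t t
| run_step u v : run t u -> step u v -> run t v.

Lemma run_trans t u v : run t u -> run u v -> run t v.
Proof. by move=> tu; elim=> // x y _; apply: run_step. Qed.

Lemma run1 t u : step t u -> run t u.
Proof. by apply: run_step; apply: run_refl. Qed.

End Machine.

Definition tau_formula := formula tau_bin_un.

Definition edge (u v : var) : tau_formula := @Rel tau_bin_un Bin [tuple u; v].
Definition mark (k : nat) (u : var) : tau_formula := @Rel tau_bin_un (Un k) [tuple u].
Definition topF : tau_formula := Eq 3 3.
Definition impF (a b : tau_formula) := Or (neg a) b.
Definition conjF (s : seq tau_formula) : tau_formula := foldr (@And tau_bin_un) topF s.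

Definition allF (F : nat -> tau_formula) (s : seq nat) : tau_formula :=
  foldr (fun k phi => And (F k) phi) topF s.

(* [mark 0], [mark 1], [mark 2] give the length of the history modulo 3, which
   orients the symmetric edges. *)
Definition prevF (v u : var) : tau_formula :=
  And (edge u v) (And (edge v u)
    (Or (And (mark 0 u) (mark 1 v))
        (Or (And (mark 1 u) (mark 2 v)) (And (mark 2 u) (mark 0 v))))).
Definition ptrF (v u : var) : tau_formula := And (edge u v) (neg (edge v u)).
Definition startF (u : var) := mark 3 u.
(** Above the four reserved marks, even indices encode program counters and odd ones tags. *)
Definition pcF (a : nat) (u : var) := mark a.*2.+4 u.
Definition tagF (k : nat) (u : var) := mark k.*2.+4.+1 u.

Definition moveF (m : move) : tau_formula :=
  match m with
  | Stay => ptrF 0 3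
  | PrevOfPtr => prevF 1 3
  | PtrOfPtr => ptrF 1 3
  | Recall => prevF 0 3
  end.

Definition actionF (A : action) : tau_formula :=
  And (pcF (goto A) 2) (And (tagF (written A).+1 2) (impF (ptrF 2 3) (moveF (mov A)))).

(** The first disjunct excuses triples that lead back to a start node. Variable 3 is universal, so
    the conditions on it constrain every possible predecessor and pointer of 2. *)
Definition instrF (a : nat) (i : instr) : tau_formula :=
  Or (startF 2) (impF (pcF a 0)
    (And (impF (prevF 2 3) (Eq 3 0))
         (And (impF (tagF (tested i) 1) (actionF (act_eq i)))
              (Or (tagF (tested i) 1) (actionF (act_neq i)))))).

Definition exclusiveF (L : seq nat) : tau_formula :=
  allF (fun k => allF (fun k' =>
    if k == k' then topF else impF (tagF k 3) (neg (tagF k' 3))) L) L.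

Definition frameF (L : seq nat) (bad : nat) : tau_formula :=
  conjF [:: Neq 0 1; ptrF 0 1; impF (ptrF 0 3) (Eq 3 1);
    impF (startF 0) (conjF [:: pcF 1 0; tagF 1 0; tagF 0 1; impF (prevF 0 3) (tagF 0 3)]);
    neg (pcF bad 0); exclusiveF L].

(* Together with [Neq 0 1], forces every first component of the team to occur in
   some triple satisfying lit: the assignments with 3 and 0 unequal satisfy the
   inclusion atom, which sends them to assignments with 3 and 0 equal. *)
Definition forceF (lit : tau_formula) : tau_formula :=
  Or (Eq 3 0) (And (Or (Neq 3 0) lit) (Inc5 [tuple 0; 0; 0; 0; 0] [tuple 0; 0; 0; 0; 3])).

(** The first [forceF] yields a start node from which the run begins; the second gives every node a
    triple that [instrF] does not excuse. *)
Definition coreF (chi : tau_formula) : tau_formula :=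
  And (Inc5 [tuple 2; 2; 2; 2; 2] [tuple 0; 0; 0; 0; 0])
      (And (forceF (startF 2)) (And (forceF (neg (startF 2))) chi)).

Definition good_flat (phi : tau_formula) := flat phi && all (gtn 4) (free_vars phi).

Lemma good_flat_And a b : good_flat (And a b) = good_flat a && good_flat b.
Proof. by rewrite /good_flat /= all_cat andbACA. Qed.

Lemma good_flat_allF F s : (forall k, good_flat (F k)) -> good_flat (allF F s).
Proof. by move=> gF; elim: s => //= k s IHs; rewrite good_flat_And gF. Qed.

Lemma good_flat_instrF a i : good_flat (instrF a i).
Proof. by case: i => k [d [] b] [d' [] b']. Qed.

Lemma good_flat_frameF L bad : good_flat (frameF L bad).
Proof.
have gL : good_flat (exclusiveF L).
  by apply: good_flat_allF => k; apply: good_flat_allF => k'; case: ifP.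
by rewrite /frameF /conjF /= !good_flat_And gL.
Qed.

(** * What the inclusion atoms say about the ternary relation of the team *)

Section Semantics.
Variable M : structure tau_bin_un.
Implicit Types (e : env M) (T : M -> M -> M -> Prop).

Definition triples T : team M := env_team (fun e => T (val4 e 0) (val4 e 1) (val4 e 2)).

Definition edgeM (u v : M) : Prop := @interp _ M Bin [tuple u; v].
Definition markM (k : nat) (u : M) : Prop := @interp _ M (Un k) [tuple u].

Definition prevM v u := edgeM u v /\ edgeM v u /\
  ((markM 0 u /\ markM 1 v) \/ (markM 1 u /\ markM 2 v) \/ (markM 2 u /\ markM 0 v)).
Definition ptrM v u := edgeM u v /\ ~ edgeM v u.

Lemma eval_edge e u v : eval e (edge u v) <-> edgeM (val4 e u) (val4 e v).
Proof.
rewrite /edgeM /=; set s := map_tuple _ _; set t := [tuple _; _].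
by have -> : s = t by apply: val_inj.
Qed.

Lemma eval_mark e k u : eval e (mark k u) <-> markM k (val4 e u).
Proof.
rewrite /markM /=; set s := map_tuple _ _; set t := [tuple _].
by have -> : s = t by apply: val_inj.
Qed.

Lemma eval_prev e v u : eval e (prevF v u) <-> prevM (val4 e v) (val4 e u).
Proof. by rewrite /prevM -!eval_edge -!eval_mark. Qed.

Lemma eval_ptr e v u : eval e (ptrF v u) <-> ptrM (val4 e v) (val4 e u).
Proof. by rewrite /ptrM -!eval_edge. Qed.

Lemma eval_imp e a b : flat a -> eval e (impF a b) <-> (eval e a -> eval e b).
Proof.
move=> fa /=; rewrite eval_neg //; split=> [[]//|h].
by have [/h|] := pselect (eval e a); [right|left].
Qed.

Lemma eval_allF e F s : eval e (allF F s) <-> {in s, forall k, eval e (F k)}.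
Proof.
elim: s => [|k s IHs]; first by split.
split=> [[ek /IHs es] k'|h]; first by rewrite inE => /predU1P[->|/es].
split; first by apply: h; rewrite mem_head.
by apply/IHs => k' k's; apply: h; rewrite inE k's orbT.
Qed.

Lemma eval_exclusive e L :
  eval e (exclusiveF L) <->
  {in L &, forall k k', markM k.*2.+4.+1 (val4 e 3) -> markM k'.*2.+4.+1 (val4 e 3) -> k = k'}.
Proof.
split=> [/eval_allF h k k' kL k'L|h].
  have /eval_allF/(_ k' k'L) := h k kL; case: eqP => // _ /eval_imp.
  by move=> /(_ isT); rewrite eval_neg // !eval_mark => h' /h'.
apply/eval_allF => k kL; apply/eval_allF => k' k'L; case: eqP => // nk.
by apply/eval_imp => //; rewrite eval_neg // !eval_mark => mk /(h k k' kL k'L mk).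
Qed.

Lemma force_sound T lit a b c : good_flat lit -> holds (triples T) (forceF lit) ->
  T a b c -> a <> b -> exists b' c', T a b' c' /\ @eval _ M (a, b', c', a) lit.
Proof.
move=> /andP[fl vl] /holds_or[Q1 [Q2 [E h1 /holds_and[h2 h3]]]] Tabc ab.
(* Giving variable 3 the value [b], different from [a], keeps this assignment out of the first
   disjunct; the inclusion atom then sends it to an assignment where 0 and 3 are both [a]. *)
have q2 : Q2 (a, b, c, b).
  have /E[] // : T (val4 (a, b, c, b) 0) (val4 (a, b, c, b) 1) (val4 (a, b, c, b) 2) by [].
  by move/holds_flat: h1 => /(_ isT isT) h1 /h1 /= /esym.
move/holds_inc: h3 => /(_ isT isT)/(_ _ q2) [[[[a' b'] c'] d'] q' /= [ea _ _ _ ed]].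
exists b', c'; rewrite ea; split; first by apply/(E (a', b', c', d')); right.
move/holds_flat: h2 => /=; rewrite fl => /(_ isT vl)/(_ _ q') /= [|].
  by rewrite -ea -ed.
by rewrite -ed -ea.
Qed.

Lemma force_complete T lit : good_flat lit ->
  (forall a b c d : M, @eval _ M (a, b, c, d) lit <-> @eval _ M (a, b, c, a) lit) ->
  (forall a b c, T a b c -> exists b' c', T a b' c' /\ @eval _ M (a, b', c', a) lit) ->
  holds (triples T) (forceF lit).
Proof.
move=> /andP[fl vl] indep h; apply/holds_or.
pose Q e := T (val4 e 0) (val4 e 1) (val4 e 2).
(* The two parts overlap where 3 equals 0 and [lit] holds; such assignments are the targets of the
   inclusion atom. *)
exists (fun e => Q e /\ val4 e 3 = val4 e 0),
  (fun e => Q e /\ (val4 e 3 <> val4 e 0 \/ eval e lit)).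
split.
- move=> e; split=> [q|[[]|[]]//].
  by have [?|?] := pselect (val4 e 3 = val4 e 0); [left|right; split; [|left]].
- by apply/holds_flat => // e [].
apply/holds_and; split.
  have fl' : flat (Or (Neq 3 0) lit) by [].
  by apply/(holds_flat _ fl') => // e [].
apply/holds_inc => // -[[[a b] c] d] [q _].
have [b' [c' [Tabc l]]] := h _ _ _ q.
by exists (a, b', c', a) => //=; split=> //; right.
Qed.

Lemma core_sound T chi : good_flat chi -> holds (triples T) (coreF chi) ->
  (forall a b c, T a b c -> a <> b) ->
  [/\ forall a b c, T a b c -> exists b' c', T c b' c',
      forall a b c, T a b c -> exists b' c', T a b' c' /\ markM 3 c',
      forall a b c, T a b c -> exists b' c', T a b' c' /\ ~ markM 3 c' &
      forall e, T (val4 e 0) (val4 e 1) (val4 e 2) -> eval e chi].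
Proof.
move=> /andP[fchi vchi] /holds_and[/holds_inc hi /holds_and[hs /holds_and[hn hc]]] ne; split.
- move=> a b c Tabc.
  have [[[[a' b'] c'] d'] /= q [ec _ _ _ _]] := hi isT isT (a, b, c, a) Tabc.
  by exists b', c'; rewrite ec.
- move=> a b c Tabc.
  have [b' [c' [q /eval_mark l]]] := force_sound (lit := startF 2) isT hs Tabc (ne _ _ _ Tabc).
  by exists b', c'.
- move=> a b c Tabc.
  have [b' [c' [q]]] := force_sound (lit := neg (startF 2)) isT hn Tabc (ne _ _ _ Tabc).
  by rewrite eval_neg // => /eval_mark ?; exists b', c'.
- exact: (holds_flat _ fchi vchi).1 hc.
Qed.

Lemma core_complete T chi : good_flat chi ->
  (forall a b c, T a b c -> exists b' c', T c b' c') ->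
  (forall a b c, T a b c -> exists b' c', T a b' c' /\ markM 3 c') ->
  (forall a b c, T a b c -> exists b' c', T a b' c' /\ ~ markM 3 c') ->
  (forall e, T (val4 e 0) (val4 e 1) (val4 e 2) -> eval e chi) ->
  holds (triples T) (coreF chi).
Proof.
move=> /andP[fchi vchi] hi hs hn hc; split.
  apply/holds_inc => // -[[[a b] c] d] /= /hi[b' [c' Tc]].
  by exists (c, b', c', c).
split.
  apply: force_complete => // [a b c d|a b c /hs[b' [c' [? ?]]]].
    by rewrite !eval_mark.
  by exists b', c'; rewrite eval_mark.
split; last exact: (holds_flat _ fchi vchi).2.
apply: force_complete => // [a b c d|a b c /hn[b' [c' [? ?]]]].
  by rewrite !eval_neg // !eval_mark.
by exists b', c'; rewrite eval_neg // eval_mark.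
Qed.

End Semantics.

(** * Frame and instruction formulas as conditions on elements of the model *)

Section FormulaMeaning.
Variable M : structure tau_bin_un.
Implicit Types a b c d : M.

Definition pcM n a := markM n.*2.+4 a.
Definition tagM k a := markM k.*2.+4.+1 a.

Definition moveM m a b d : Prop :=
  match m with
  | Stay => ptrM a d
  | PrevOfPtr => prevM b d
  | PtrOfPtr => ptrM b d
  | Recall => prevM a d
  end.

Definition actionM A a b c d : Prop :=
  [/\ pcM (goto A) c, tagM (written A).+1 c & ptrM c d -> moveM (mov A) a b d].

Definition instrM n i a b c d : Prop :=
  markM 3 c \/ (pcM n a -> [/\ prevM c d -> d = a,
    tagM (tested i) b -> actionM (act_eq i) a b c d &
    tagM (tested i) b \/ actionM (act_neq i) a b c d]).

Definition startM a b d : Prop :=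
  [/\ pcM 1 a, tagM 1 a, tagM 0 b & prevM a d -> tagM 0 d].

Record frameM (L : seq nat) bad a b c d : Prop := FrameM {
  frame_neq : a <> b;
  frame_ptr : ptrM a b;
  frame_ptr_uniq : ptrM a d -> d = b;
  frame_start : markM 3 a -> startM a b d;
  frame_bad : ~ pcM bad a;
  frame_tag : {in L &, forall k k', tagM k d -> tagM k' d -> k = k'} }.

Lemma eval_move (a b c d : M) m : @eval _ M (a, b, c, d) (moveF m) <-> moveM m a b d.
Proof. by case: m; rewrite ?eval_ptr ?eval_prev. Qed.

Lemma eval_action a b c d A :
  @eval _ M (a, b, c, d) (actionF A) <-> actionM A a b c d.
Proof.
have -> : @eval _ M (a, b, c, d) (actionF A) <->
    eval (a, b, c, d) (pcF (goto A) 2) /\ eval (a, b, c, d) (tagF (written A).+1 2) /\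
    eval (a, b, c, d) (impF (ptrF 2 3) (moveF (mov A))) by [].
rewrite eval_imp // eval_ptr eval_move !eval_mark.
by split=> [[? []]|[]].
Qed.

Lemma eval_instr a b c d n i :
  @eval _ M (a, b, c, d) (instrF n i) <-> instrM n i a b c d.
Proof.
pose ev := @eval _ M (a, b, c, d); rewrite -/ev.
have -> : ev (instrF n i) <-> ev (startF 2) \/ ev (impF (pcF n 0)
    (And (impF (prevF 2 3) (Eq 3 0)) (And (impF (tagF (tested i) 1) (actionF (act_eq i)))
         (Or (tagF (tested i) 1) (actionF (act_neq i)))))) by [].
rewrite /ev eval_imp // -/ev.
have -> : ev (And (impF (prevF 2 3) (Eq 3 0))
         (And (impF (tagF (tested i) 1) (actionF (act_eq i)))
         (Or (tagF (tested i) 1) (actionF (act_neq i))))) <->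
    ev (impF (prevF 2 3) (Eq 3 0)) /\
    ev (impF (tagF (tested i) 1) (actionF (act_eq i))) /\
    (ev (tagF (tested i) 1) \/ ev (actionF (act_neq i))) by [].
rewrite /ev !eval_imp // !eval_action eval_prev !eval_mark /instrM.
by split=> -[|h]; [left|right=> /h[? []]|left|right=> /h[]].
Qed.

Lemma eval_frame a b c d L bad :
  @eval _ M (a, b, c, d) (frameF L bad) <-> frameM L bad a b c d.
Proof.
have -> : @eval _ M (a, b, c, d) (frameF L bad) <->
  a <> b /\ eval (a, b, c, d) (ptrF 0 1) /\ eval (a, b, c, d) (impF (ptrF 0 3) (Eq 3 1)) /\
  eval (a, b, c, d) (impF (startF 0) (conjF [:: pcF 1 0; tagF 1 0; tagF 0 1;
    impF (prevF 0 3) (tagF 0 3)])) /\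
  eval (a, b, c, d) (neg (pcF bad 0)) /\ eval (a, b, c, d) (exclusiveF L) /\ True.
  by rewrite /frameF; split=> [[? [? [? [? [? []]]]]]|[? [? [? [? [? []]]]]]].
rewrite !eval_imp // eval_neg // eval_exclusive.
have -> : @eval _ M (a, b, c, d) (conjF [:: pcF 1 0; tagF 1 0; tagF 0 1;
    impF (prevF 0 3) (tagF 0 3)]) <-> eval (a, b, c, d) (pcF 1 0) /\
   eval (a, b, c, d) (tagF 1 0) /\ eval (a, b, c, d) (tagF 0 1) /\
   eval (a, b, c, d) (impF (prevF 0 3) (tagF 0 3)) /\ True.
  by split=> [[? [? [? []]]]|[? [? [? []]]]].
rewrite eval_imp // !eval_ptr !eval_prev !eval_mark; split.
  move=> [? [? [? [h [? [? _]]]]]]; split=> //.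
  by case/h=> ? [? [? []]].
by move=> [? ? ? h ? ?]; do 4!split=> //; move=> /h[].
Qed.

End FormulaMeaning.

Section Simulation.
Variables (L : seq nat) (bad : nat) (pcs : seq nat) (code : nat -> instr).

Hypothesis L0 : 0 \in L.
Hypothesis L1 : 1 \in L.
Hypothesis L_code : {in pcs, forall n, [/\ tested (code n) \in L,
  (written (act_eq (code n))).+1 \in L & (written (act_neq (code n))).+1 \in L]}.

Definition root_pc (t : tree) : option nat := if t is Node n _ _ _ then Some n else None.

(** * Soundness: every model contains the run *)

Section Soundness.
Variables (M : structure tau_bin_un) (T : M -> M -> M -> Prop).
Hypothesis T_next : forall a b c, T a b c -> exists b' c', T c b' c'.
Hypothesis T_start : forall a b c, T a b c -> exists b' c', T a b' c' /\ markM 3 c'.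
Hypothesis T_step : forall a b c, T a b c -> exists b' c', T a b' c' /\ ~ markM 3 c'.
Hypothesis T_frame : forall a b c d, T a b c -> frameM L bad a b c d.
Hypothesis T_instr : forall a b c d, T a b c -> {in pcs, forall n, instrM n (code n) a b c d}.

(* Universally quantified over predecessors and targets: their existence is
   only ever needed at the root, where it comes from [frame_ptr]. *)
Fixpoint represents (t : tree) (h : M) : Prop :=
  match t with
  | Leaf _ => tagM 0 h
  | Node n k p c => [/\ pcM n h, tagM k.+1 h, k.+1 \in L,
      forall u, prevM h u -> represents p u & forall u, ptrM h u -> represents c u]
  end.

Lemma represents_tag t h : represents t h -> tagM (root_tag t) h /\ root_tag t \in L.
Proof. by case: t => [b|n k p c] //= []. Qed.

(** A start node occurs as a third component by [T_start]; [T_next] makes it a first component,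
    where its frame conditions apply. Both children of [start_tree] are leaves, of which only tag 0
    is asked. *)
Lemma start_represented a b c : T a b c ->
  exists2 h, represents start_tree h & exists b' c', T h b' c'.
Proof.
move=> /T_start[b' [h [/T_next[b1 [c1 Th]] sh]]]; exists h; last by exists b1, c1.
have F d := T_frame d Th; split=> //.
- by have [] := frame_start (F h) sh.
- by have [] := frame_start (F h) sh.
- by move=> u; have [] := frame_start (F u) sh.
- by move=> u /(frame_ptr_uniq (F u)) ->; have [] := frame_start (F u) sh.
Qed.

(** [T_step] supplies a triple with a non-start third component, so [instrM] must describe that
    component as the successor. *)
Lemma step_represented t t' h : step pcs code t t' ->
  represents t h -> (exists b c, T h b c) ->
  exists2 h', represents t' h' & exists b c, T h' b c.
Proof.
move=> [n k p c c' npcs Ec'] rt [b0 [c0 /T_step[b [h' [Th ns]]]]].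
exists h'; last exact: T_next Th.
have [pn tk kL rp rc] := rt; have rb : represents c b by apply/rc/frame_ptr/(T_frame h Th).
have I d : [/\ prevM h' d -> d = h,
  tagM (tested (code n)) b -> actionM (act_eq (code n)) h b h' d &
  tagM (tested (code n)) b \/ actionM (act_neq (code n)) h b h' d].
  by have [//|/(_ pn)] := T_instr d Th npcs.
have [tL wL wL'] := L_code npcs; have [tb cL] := represents_tag rb.
have A d : actionM (act (code n) c) h b h' d.
  rewrite /act; have [_ h1 h2] := I d; case: eqP => [E|ne]; first by apply: h1; rewrite -E.
  (* If the test fails in the tree it also fails in the model, because tags from [L] exclude each
     other at the pointer [b]. *)
  case: h2 => // tb'; case: ne; exact: frame_tag (T_frame b Th) _ _ cL tL tb tb'.
have [pg wt _] := A h; split=> //.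
- by rewrite /act; case: ifP.
- by move=> u; have [E _ _] := I u => /E ->.
move=> u pu; have [_ _ /(_ pu)] := A u.
move: Ec'; case: (mov _) => /= [[<-]|||[<-]] //.
- by move/rc.
- by case: c {A I rt} rc rb tb cL pg wt => // n1 k1 p1 c1 _ [_ _ _ r1 _] _ _ _ _ [<-]; apply: r1.
- by case: c {A I rt} rc rb tb cL pg wt => // n1 k1 p1 c1 _ [_ _ _ _ r1] _ _ _ _ [<-]; apply: r1.
- by move/rp.
Qed.

Lemma bad_unreachable t : (exists a b c, T a b c) ->
  run pcs code start_tree t -> root_pc t <> Some bad.
Proof.
move=> [a [b [c /start_represented[h0 r0 T0]]]] rn.
have [h] : exists2 h, represents t h & exists b c, T h b c.
  by elim: rn => [|u v _ [h rh Th] /step_represented]; [exists h0|apply; eauto].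
case: t {rn} => //= n k p c1 [pn _ _ _ _] [b' [c' Th]] [E].
by case: (frame_bad (T_frame h Th)); rewrite -E.
Qed.

End Soundness.

(** * Structure of history trees *)

Fixpoint subtrees (t : tree) : seq tree :=
  t :: if t is Node _ _ p c then subtrees p ++ subtrees c else [::].

Fixpoint chain (t : tree) : seq tree :=
  if t is Node _ _ p _ then t :: chain p else [::].

Fixpoint depth (t : tree) : nat := if t is Node _ _ p _ then (depth p).+1 else 0.

(** With pointers strictly less deep than their node and different from its predecessor, a pointer
    edge is never symmetric. *)
Fixpoint sane (t : tree) : Prop :=
  if t is Node _ _ p c then [/\ sane p, sane c, c <> p & depth c <= depth p] else True.

Definition is_prev (v u : tree) : Prop := if v is Node _ _ p _ then u = p else False.
Definition is_ptr (v u : tree) : Prop := if v is Node _ _ _ c then u = c else False.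

Lemma subtrees_refl t : t \in subtrees t.
Proof. by case: t => *; rewrite mem_head. Qed.

Lemma subtrees_trans t u v : u \in subtrees t -> v \in subtrees u -> v \in subtrees t.
Proof.
elim: t => [b|n k p IHp c IHc] /=; first by rewrite inE => /eqP ->.
rewrite inE mem_cat => /predU1P[-> //|/orP[/IHp h|/IHc h] /h]; rewrite inE mem_cat => ->.
  by rewrite orbT.
by rewrite !orbT.
Qed.

Lemma subtrees_sub t v u : v \in subtrees t -> is_prev v u \/ is_ptr v u -> u \in subtrees t.
Proof.
move=> vt uv; apply: subtrees_trans vt _.
by case: v uv => [b []|n k p c [] /= ->] //; rewrite inE mem_cat subtrees_refl ?orbT.
Qed.

Lemma chain_subtrees t u : u \in chain t -> u \in subtrees t.
Proof.
elim: t => [b //|n k p IHp c _] /=; rewrite !inE mem_cat => /orP[->//|/IHp ->].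
by rewrite orbT.
Qed.

Lemma chain_node t u : u \in chain t -> exists n k p c, u = Node n k p c.
Proof.
elim: t => [b //|n k p IHp c _] /=; rewrite !inE => /predU1P[-> |/IHp//].
by exists n, k, p, c.
Qed.

Lemma sane_subtrees t u : sane t -> u \in subtrees t -> sane u.
Proof.
elim: t => [b _|n k p IHp c IHc [sp sc cp dc]] /=; first by rewrite inE => /eqP ->.
rewrite inE mem_cat => /predU1P[->|]; first by split.
by move=> /orP[/IHp|/IHc]; apply.
Qed.

Lemma depth_ptr v u : sane v -> is_ptr v u -> depth u < depth v.
Proof. by case: v => // n k p c [_ _ _ dc] ->. Qed.

Lemma depth_prev v u : is_prev v u -> depth v = (depth u).+1.
Proof. by case: v => // n k p c ->. Qed.

Lemma run_sane t : run pcs code start_tree t -> sane t.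
Proof.
elim=> [|u v _ su uv]; first by split.
case: uv su => n k p c c' _ Ec' su; have [sp sc cp dc] := su.
(* The new predecessor is one deeper than [p], so this bound also separates the new pointer from
   it. *)
suff [sc' dc'] : sane c' /\ depth c' <= depth p.
  split=> //; last exact: leqW.
  by move=> E; move: dc'; rewrite E /= ltnn.
case: (mov _) Ec' => /= [[<-]|||[<-]] //.
  case: c su sc cp dc => // n1 k1 p1 c1 _ [s1 _ _ _] _ /= d1 [<-].
  by split=> //; apply: ltnW.
case: c su sc cp dc => // n1 k1 p1 c1 _ [_ s1 _ d2] _ /= d1 [<-].
by split=> //; apply: leq_trans (ltnW d1).
Qed.

(** Each node contains its predecessors, so the last tree of a run contains the whole run. *)
Lemma run_chain t : run pcs code start_tree t ->
  start_tree \in chain t /\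
  {in chain t, forall u, u = t \/ exists2 v, v \in chain t & step pcs code u v}.
Proof.
elim=> [|u v _ [IH1 IH2] uv]; first by split; rewrite /= ?inE // => u; rewrite inE => /eqP; left.
have Ev : chain v = v :: chain u by case: uv.
have uu : u \in chain u by case: uv => *; rewrite mem_head.
rewrite Ev; split=> [|x]; first by rewrite inE IH1 orbT.
rewrite inE => /predU1P[->|/IH2[->|[y yu xy]]]; first by left.
  by right; exists v => //; rewrite mem_head.
by right; exists y => //; rewrite inE yu orbT.
Qed.

(** * Completeness: the history of a run ending in the good state is a finite model *)

Section Completeness.
Variables (good : nat) (final : tree).
Hypothesis final_run : run pcs code start_tree final.
Hypothesis final_good : root_pc final = Some good.
Hypothesis good_halts : good \notin pcs.
Hypothesis bad_halts : bad \notin pcs.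
Hypothesis good_neq_bad : good <> bad.
Hypothesis good_neq1 : good <> 1.

Definition edgeT (u v : tree) : Prop := [\/ is_prev v u, is_prev u v | is_ptr v u].

Definition markT (k : nat) (u : tree) : Prop :=
  match k with
  | 3 => u = start_tree
  | k'.+4 => if odd k' then root_tag u = k'./2 else root_pc u = Some k'./2
  | _ => depth u %% 3 = k
  end.

(** All subtrees are taken, not just the chain, since the first node needs a leaf as its pointer. *)
Definition history : Type := seq_sub (subtrees final).

Lemma history_inhabited : inhabited history.
Proof. by constructor; exists final; apply: subtrees_refl. Qed.

Definition history_interp (R : tau_sym) (s : seq history) : Prop :=
  match R, s with
  | Bin, [:: u; v] => edgeT (ssval u) (ssval v)
  | Un k, [:: u] => markT k (ssval u)
  | _, _ => False
  end.

Definition history_model : structure tau_bin_un :=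
  @Structure tau_bin_un history history_inhabited (fun R xs => history_interp R xs).

Implicit Types a b c d u v : history_model.

Lemma pc_history n u : pcM n u <-> root_pc (ssval u) = Some n.
Proof. by rewrite /pcM /markM /= odd_double /= doubleK. Qed.

Lemma tag_history n u : tagM n u <-> root_tag (ssval u) = n.
Proof. by rewrite /tagM /markM /= odd_double /= uphalf_double. Qed.

Lemma sane_history u : sane (ssval u).
Proof. exact: sane_subtrees (run_sane final_run) (ssvalP u). Qed.

Lemma ptr_history v u : ptrM v u <-> is_ptr (ssval v) (ssval u).
Proof.
rewrite /ptrM /edgeM /=; split=> [[[] // h []]|vu]; first by constructor 2.
  by constructor 1.
split; first by constructor 3.
have lt := depth_ptr (sane_history v) vu.
case=> [/depth_prev E|h|/(depth_ptr (sane_history u))].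
- by move: lt; rewrite E ltnNge leqW.
- have := sane_history v; case: (ssval v) vu h => // n k p c /= -> cp [_ _ /(_ cp)].
  by [].
- by move/(ltn_trans lt); rewrite ltnn.
Qed.

(** A symmetric edge joins a node and its predecessor, whose depths differ by one; residues modulo 3
    tell plus one from minus one. *)
Lemma prev_history v u : prevM v u <-> is_prev (ssval v) (ssval u).
Proof.
rewrite /prevM /edgeM /markM /=; split.
  move=> [[//|uv|vu] [e2 m]].
    move: m; rewrite (depth_prev uv) -[(depth _).+1]addn1 -modnDml.
    by move=> [[h E]|[[h E]|[h E]]]; rewrite E in h.
  have lt := depth_ptr (sane_history v) vu.
  case: e2 => // [/depth_prev E|/(depth_ptr (sane_history u))].
    by move: lt; rewrite E ltnNge leqW.
  by move/(ltn_trans lt); rewrite ltnn.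
move=> vu; split; [by constructor 1|split; first by constructor 2].
rewrite (depth_prev vu) -[(depth _).+1]addn1 -modnDml.
by case: (depth _ %% 3) (ltn_pmod (depth (ssval u)) (isT : 0 < 3)) => [|[|[|]]] //=; auto.
Qed.

(** The loop at [final] supplies the non-start triple that the last node must have; no instruction
    constrains it, as [good] is not in [pcs]. *)
Definition history_triple a b c : Prop :=
  [/\ ssval a \in chain final, is_ptr (ssval a) (ssval b) &
    [\/ ssval c = start_tree, step pcs code (ssval a) (ssval c) /\ ssval c \in chain final
      | ssval a = final /\ ssval c = final]].

Lemma final_chain : final \in chain final.
Proof. by case: final final_good => // *; rewrite mem_head. Qed.

Lemma start_in_history : start_tree \in subtrees final.
Proof. by have [/chain_subtrees] := run_chain final_run. Qed.

Lemma history_ptr a : ssval a \in chain final -> exists b, is_ptr (ssval a) (ssval b).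
Proof.
case: a => t st /= /chain_node[n [k [p [c E]]]].
have cs : c \in subtrees final by apply: subtrees_sub st _; rewrite E; right.
by exists (SeqSub cs); rewrite E.
Qed.

Lemma triple_chain a b c : history_triple a b c -> ssval c \in chain final.
Proof.
by case=> _ _ [->|[]//|[_ ->]]; [have [] := run_chain final_run|apply: final_chain].
Qed.

Lemma triple_start a : ssval a \in chain final ->
  exists b c, history_triple a b c /\ markM 3 c.
Proof.
move=> ac; have [b ab] := history_ptr ac.
by exists b, (SeqSub start_in_history); split=> //; split=> //; constructor 1.
Qed.

Lemma triple_step a : ssval a \in chain final ->
  exists b c, history_triple a b c /\ ~ markM 3 c.
Proof.
move=> ac; have [b ab] := history_ptr ac; exists b.
have [_ /(_ _ ac)[af|[v vf av]]] := run_chain final_run.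
  exists (SeqSub (subtrees_refl final)); split; first by split=> //; constructor 3.
  by rewrite /markM /= => E; apply: good_neq1; move: final_good; rewrite E => -[].
exists (SeqSub (chain_subtrees vf)); split; first by split=> //; constructor 2.
(* The predecessor of a successor is a node, that of [start_tree] is a leaf. *)
by rewrite /markM /= => E; move: av; rewrite E => av; inversion av.
Qed.

Lemma triple_frame a b c d : history_triple a b c -> frameM L bad a b c d.
Proof.
move=> [ac ab abc]; split.
- by move=> E; have := depth_ptr (sane_history a) ab; rewrite E ltnn.
- exact/ptr_history.
- rewrite ptr_history => ad; apply: val_inj => /=.
  by case: (ssval a) ab ad => // n k p c1 /= -> ->.
- rewrite /markM /= => E; move: ab; rewrite E /= => ab.
  by split; rewrite ?pc_history ?tag_history ?prev_history ?E ?ab //= => ->.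
(* The last node of the chain is in state [good]; every other one has made a step, so its state lies
   in [pcs]. *)
- rewrite pc_history => E; have [_ /(_ _ ac)[af|[v _ av]]] := run_chain final_run.
    by apply: good_neq_bad; move: E; rewrite af final_good => -[].
  by case: av E => n k p c1 c' npcs _ [E]; move: bad_halts; rewrite -E npcs.
- by move=> k k' _ _; rewrite !tag_history => -> ->.
Qed.

Lemma triple_instr a b c d : history_triple a b c ->
  {in pcs, forall n, instrM n (code n) a b c d}.
Proof.
move=> [ac ab abc] n npcs; rewrite /instrM pc_history.
case: abc => [?|[st _]|[af _]]; [by left|right|right=> E]; last first.
  by move: E good_halts; rewrite af final_good => -[->]; rewrite npcs.
move=> En.
have [k [p [t1 [t2 [Ea Ec Em]]]]] : exists k p t1 t2, [/\ ssval a = Node n k p t1,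
    ssval c = Node (goto (act (code n) t1)) (written (act (code n) t1)) (ssval a) t2 &
    move_ptr (mov (act (code n) t1)) p t1 = Some t2].
  by case: st En => n' k p t1 t2 _ Em [<-]; exists k, p, t1, t2.
have Eb : ssval b = t1 by move: ab; rewrite Ea.
have A : actionM (act (code n) t1) a b c d.
  split; rewrite ?pc_history ?tag_history ?ptr_history Ec //= => Ed.
  move: Em; case: (mov _) => /= [[E]|||[E]].
  - by rewrite ptr_history Ea /= E.
  - by case: t1 Ea Ec Eb => // n1 k1 p1 t3 _ _ Eb [E]; rewrite prev_history Eb /= E.
  - by case: t1 Ea Ec Eb => // n1 k1 p1 t3 _ _ Eb [E]; rewrite ptr_history Eb /= E.
  - by rewrite prev_history Ea /= E.
rewrite /act in A; split; rewrite ?tag_history ?Eb.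
- by rewrite prev_history Ec /= => /val_inj.
- by move=> E; move: A; rewrite E eqxx.
- by case: eqP A; [left|right].
Qed.

Lemma history_finite : finite_set [set: history_model].
Proof. exact: finite_finset. Qed.

End Completeness.

End Simulation.

(** * Register programs *)

Inductive rinstr :=
| RMov of nat & nat & nat
| RInc of nat & nat & nat
| RJz of nat & nat & nat & nat.

Definition upd (g : nat -> nat) (x v : nat) : nat -> nat :=
  fun z => if z == x then v else g z.

Definition rexec (i : rinstr) (g : nat -> nat) : nat * (nat -> nat) :=
  match i with
  | RMov x y l => (l, upd g x (g y))
  | RInc x y l => (l, upd g x (g y).+1)
  | RJz y x l0 l1 => if g y is n.+1 then (l1, upd g x n) else (l0, g)
  end.

(** Each register instruction owns six machine states. They are even, the odd ones being reserved
    for the input phase. *)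
Definition pc (l j : nat) : nat := (6 * l + j).*2.

Definition source (i : rinstr) : nat :=
  match i with RMov _ y _ | RInc _ y _ | RJz y _ _ _ => y end.

(* Register x is the pointer of the latest node written with tag x.+1; the tag
   0 is neutral.  States 0 and 1 point the cursor at the current node, states 2
   and 3 walk back to the latest value of the source register. *)
Definition block (i : rinstr) (l j : nat) : instr :=
  match j, i with
  | 0, _ => jump (Action 0 Stay (pc l 1))
  | 1, _ => jump (Action 0 Recall (pc l 2))
  | 2, _ => Instr (source i).+2 (Action 0 PtrOfPtr (pc l 4)) (Action 0 Stay (pc l 3))
  | 3, _ => Instr 0 (Action 0 Stay (pc l 4)) (Action 0 PrevOfPtr (pc l 2))
  | 4, RMov x _ l' => jump (Action x.+1 Stay (pc l' 0))
  | 4, RInc _ _ _ => jump (Action 0 Stay (pc l 5))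
  | 4, RJz _ x l0 l1 => Instr 0 (Action 0 Stay (pc l0 0)) (Action x.+1 PtrOfPtr (pc l1 0))
  | _, RMov x _ l' | _, RInc x _ l' => jump (Action x.+1 Recall (pc l' 0))
  | _, RJz _ x l' _ => jump (Action x.+1 Recall (pc l' 0))
  end.

Definition block_code (rp : seq rinstr) (q : nat) : instr :=
  block (nth (RMov 0 0 0) rp (q %/ 6)) (q %/ 6) (q %% 6).

(** The input phase is kept outside the program [rp], so that only its formulas vary with the
    input. *)
Definition input_instr (j : nat) : instr := jump (Action 0 Recall j.+1.*2.+1).
Definition input_end : instr := jump (Action 1 Stay 0).

Definition code (rp : seq rinstr) (m a : nat) : instr :=
  if odd a then if a./2 < m then input_instr a./2 else input_end
  else block_code rp a./2.

Definition pcs (rp : seq rinstr) (m : nat) : seq nat :=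
  [seq q.*2 | q <- iota 0 (6 * size rp)] ++ [seq q.*2.+1 | q <- iota 0 m.+1].

Lemma act_jump A c : act (jump A) c = A.
Proof. by rewrite /act if_same. Qed.

Fixpoint number (n : nat) (t : tree) : Prop :=
  match n, t with
  | 0, Leaf _ => True
  | n'.+1, Node _ _ _ c => number n' c
  | _, _ => False
  end.

(** A register never written yields the leaf at the end of the chain, hence the value 0. *)
Fixpoint latest (x : nat) (t : tree) : tree :=
  if t is Node _ d p c then if d == x.+1 then c else latest x p else t.

Definition registers (g : nat -> nat) (t : tree) : Prop :=
  forall x, number (g x) (latest x t).

(** * Register instructions carried out by the history machine *)

Section Execution.
Variables (rp : seq rinstr) (m : nat).
Notation run := (run (pcs rp m) (code rp m)).
Notation rnth := (nth (RMov 0 0 0) rp).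

Lemma block_run l j d p c c' e b a (t := Node (pc l j) d p c) :
  l < size rp -> j < 6 -> act (block (rnth l) l j) c = Action e b a ->
  move_ptr b p c = Some c' -> run t (Node a e t c').
Proof.
move=> ls lj Ea Em; have Ei : code rp m (pc l j) = block (rnth l) l j.
  rewrite /code /pc odd_double doubleK /block_code mulnC divnMDl // divn_small // addn0.
  by rewrite modnMDl modn_small.
have : step (pcs rp m) (code rp m) t
    (Node (goto (act (code rp m (pc l j)) c)) (written (act (code rp m (pc l j)) c)) t c').
  constructor; last by rewrite Ei Ea.
  rewrite mem_cat /pc map_f // mem_iota add0n /=.
  rewrite -(ltn_add2l (6 * l)) [X in _ < X]addnC -mulnS in lj.
  by apply: leq_trans lj _; rewrite leq_mul2l ls orbT.
by rewrite Ei Ea; apply: run1.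
Qed.

(** Induction on the cursor [u], replaced by its predecessor in each round. The nodes written
    meanwhile have tag 0 and do not affect [latest]; a cursor arriving at a leaf stops there with
    the value zero. *)
Lemma read_run l u d p (t := Node (pc l 2) d p u) : l < size rp ->
  exists p', run t (Node (pc l 4) 0 p' (latest (source (rnth l)) u)) /\
    forall x, latest x p' = latest x t.
Proof.
move=> ls; rewrite {}/t; elim: u d p => [b|n k p1 IHp c1 _] d p.
  set t := Node _ _ _ _; pose t3 := Node (pc l 3) 0 t (Leaf b); exists t3; split=> //.
  apply: (run_trans (u := t3)).
    exact: (@block_run l 2 d p (Leaf b) _ 0 Stay (pc l 3)).
  exact: (@block_run l 3 0 t (Leaf b) _ 0 Stay (pc l 4)).
set t := Node _ _ _ _; rewrite /=; case: eqP => Ek.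
  exists t; split=> //; apply: (@block_run l 2 d p (Node n k p1 c1) _ 0 PtrOfPtr (pc l 4)) => //.
  by rewrite /act /= eqSS Ek eqxx.
pose t3 := Node (pc l 3) 0 t (Node n k p1 c1).
have [p' [r' E']] := IHp 0 t3; exists p'; split=> //.
apply: run_trans r'; apply: (run_trans (u := t3)).
  apply: (@block_run l 2 d p (Node n k p1 c1) _ 0 Stay (pc l 3)) => //.
  by rewrite /act /= eqSS; case: eqP.
exact: (@block_run l 3 0 t (Node n k p1 c1) _ 0 PrevOfPtr (pc l 2)).
Qed.

Lemma registers_upd g t n p c x v : registers g p -> number v c ->
  t = Node n x.+1 p c -> registers (upd g x v) t.
Proof.
move=> gp vc -> y; rewrite /= /upd eqSS eq_sym.
by case: eqP => // _; apply: gp.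
Qed.

(** After the search, [t4] points to the value read. A move writes this pointer under the new tag,
    an increment points to [t4] itself, one link longer, and a decrement follows one link. *)
Lemma rinstr_run l g t (r := rexec (rnth l) g) :
  l < size rp -> root_pc t = Some (pc l 0) -> registers g t ->
  exists t', [/\ run t t', root_pc t' = Some (pc r.1 0) & registers r.2 t'].
Proof.
move=> ls; case: t => // n d p c [->] gt; set t := Node _ _ _ _ in gt *.
(* [Recall] fetches the predecessor, so it is executed at the extra node [t1] to make the search
   start at [t] itself. *)
pose t1 := Node (pc l 1) 0 t c; pose t2 := Node (pc l 2) 0 t1 t.
have [p' [r2 E2]] := read_run t 0 t1 ls.
pose y := source (rnth l); pose t4 := Node (pc l 4) 0 p' (latest y t).
have {}r2 : run t2 t4 := r2.
have g4 : registers g p' by move=> x; rewrite E2; apply: gt.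
have ny : number (g y) (latest y t) := gt y.
have rt4 : run t t4.
  apply: run_trans r2; apply: (run_trans (u := t1)).
    exact: (@block_run l 0 d p c _ 0 Stay (pc l 1) ls isT (act_jump _ _)).
  exact: (@block_run l 1 0 t c _ 0 Recall (pc l 2) ls isT (act_jump _ _)).
have := fun c' e b a => @block_run l 4 0 p' (latest y t) c' e b a ls isT.
pose t5 := Node (pc l 5) 0 t4 (latest y t).
have := fun c' e b a => @block_run l 5 0 t4 (latest y t) c' e b a ls isT.
rewrite {}/r -/t4 -/t5.
case: (rnth l) @y @t4 @t5 {r2} rt4 ny => [x y l'|x y l'|y x l0 l1] z t4 t5 rt4 ny s5 s4.
- have {}s4 := s4 _ _ _ _ (act_jump _ _) erefl; eexists; split; [exact: run_trans rt4 s4|by []|].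
  exact: registers_upd g4 ny erefl.
- have {}s4 := s4 _ _ _ _ (act_jump _ _) erefl; have {}s5 := s5 _ _ _ _ (act_jump _ _) erefl.
  eexists; split; [exact: run_trans rt4 (run_trans s4 s5)|by []|].
  exact: (@registers_upd g _ _ t5 t4 x (g y).+1 g4 ny).
- have {}ny : number (g y) (latest y t) := ny.
  have {s5}s4 : forall c' e b a, act (block (RJz y x l0 l1) l 4) (latest y t) = Action e b a ->
      move_ptr b p' (latest y t) = Some c' -> run t4 (Node a e t4 c') := s4.
  rewrite /rexec.
  case Eg: (g y) ny => [|v]; case El: (latest y t) s4 => [b|n1 k1 p1 c1] //= s4 ny.
    have {}s4 := s4 (Leaf b) 0 Stay (pc l0 0) erefl erefl.
    by eexists; split; [exact: run_trans rt4 s4|by []|].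
  have {}s4 := s4 c1 x.+1 PtrOfPtr (pc l1 0) erefl erefl.
  eexists; split; [exact: run_trans rt4 s4|by []|].
  exact: (@registers_upd g _ _ t4 c1 x v g4 ny).
Qed.

Lemma input_step j d p c c' e b a (t := Node j.*2.+1 d p c) : j <= m ->
  act (if j < m then input_instr j else input_end) c = Action e b a ->
  move_ptr b p c = Some c' -> run t (Node a e t c').
Proof.
move=> jm Ea Em.
have Ei : code rp m j.*2.+1 = if j < m then input_instr j else input_end.
  by rewrite /code /= odd_double /= uphalf_double.
have : step (pcs rp m) (code rp m) t
    (Node (goto (act (code rp m j.*2.+1) c)) (written (act (code rp m j.*2.+1) c)) t c').
  constructor; last by rewrite Ei Ea.
  by rewrite mem_cat (map_f (fun q => q.*2.+1)) ?orbT // mem_iota.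
by rewrite Ei Ea; apply: run1.
Qed.

(* Node number j of the input phase points to node number j - 2. *)
Lemma input_run : exists t, [/\ run start_tree t, root_pc t = Some (pc 0 0) &
  registers (upd (fun=> 0) 0 m./2) t].
Proof.
have phase j : j <= m -> exists p c, let t := Node j.*2.+1 0 p c in
    [/\ run start_tree t, number j./2 c, number (uphalf j) p & registers (fun=> 0) t].
  elim: j => [|j IHj] jm.
    by exists (Leaf true), (Leaf false); split=> //; apply: run_refl.
  have [p [c [rt nc np lt]]] := IHj (ltnW jm).
  exists (Node j.*2.+1 0 p c), p; split=> //.
  by apply: run_trans rt _; apply: (@input_step j 0 p c p 0 Recall); rewrite ?jm ?act_jump // ltnW.
have [p [c [rt nc _ lt]]] := phase m (leqnn m).
exists (Node 0 1 (Node m.*2.+1 0 p c) c); split=> //.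
  by apply: run_trans rt _; apply: (@input_step m 0 p c c 1 Stay); rewrite ?ltnn ?act_jump.
exact: registers_upd lt nc erefl.
Qed.

End Execution.

(** * Structured commands and their compilation *)

Inductive com :=
| CMov of nat & nat
| CInc of nat & nat
| CSeq of com & com
| CWhile of nat & com.

(** Entering a loop body decrements the loop register, because [RJz] tests and decrements at
    once. *)
Inductive exec : com -> (nat -> nat) -> (nat -> nat) -> Prop :=
| exec_mov x y g : exec (CMov x y) g (upd g x (g y))
| exec_inc x y g : exec (CInc x y) g (upd g x (g y).+1)
| exec_seq c1 c2 g1 g2 g3 : exec c1 g1 g2 -> exec c2 g2 g3 -> exec (CSeq c1 c2) g1 g3
| exec_stop y c g : g y = 0 -> exec (CWhile y c) g g
| exec_loop y c n g1 g2 g3 : g1 y = n.+1 -> exec c (upd g1 y n) g2 ->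
    exec (CWhile y c) g2 g3 -> exec (CWhile y c) g1 g3.

Fixpoint csize (c : com) : nat :=
  match c with
  | CMov _ _ | CInc _ _ => 1
  | CSeq c1 c2 => csize c1 + csize c2
  | CWhile _ c => (csize c).+2
  end.

(** [RMov y y b] copies a register to itself and serves as the jump back to the loop test. *)
Fixpoint compile (b : nat) (c : com) : seq rinstr :=
  match c with
  | CMov x y => [:: RMov x y b.+1]
  | CInc x y => [:: RInc x y b.+1]
  | CSeq c1 c2 => compile b c1 ++ compile (b + csize c1) c2
  | CWhile y c => RJz y y (b + (csize c).+2) b.+1 :: rcons (compile b.+1 c) (RMov y y b)
  end.

Lemma size_compile b c : size (compile b c) = csize c.
Proof.
by elim: c b => //= [c1 IH1 c2 IH2|y c IH] b; rewrite ?size_cat ?size_rcons ?IH1 ?IH2 ?IH.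
Qed.

Section Compilation.
Variables (rp : seq rinstr) (m : nat).

Definition placed (b : nat) (s : seq rinstr) : Prop :=
  forall i, i < size s -> b + i < size rp /\
    nth (RMov 0 0 0) rp (b + i) = nth (RMov 0 0 0) s i.

Lemma placed_cat b s1 s2 : placed b (s1 ++ s2) -> placed b s1 /\ placed (b + size s1) s2.
Proof.
move=> h; split=> i li.
  have [|? ->] := h i; first by rewrite size_cat ltn_addr.
  by rewrite nth_cat li.
have lt : (size s1 + i < size s1) = false by rewrite ltnNge leq_addr.
have := h (size s1 + i); rewrite size_cat ltn_add2l addnA nth_cat lt addKn.
exact.
Qed.

Definition reaches (l : nat) (g : nat -> nat) (t : tree) : Prop :=
  [/\ run (pcs rp m) (code rp m) start_tree t, root_pc t = Some (pc l 0) & registers g t].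

Lemma reaches_instr l g t i : placed l [:: i] -> reaches l g t ->
  exists t', reaches (rexec i g).1 (rexec i g).2 t'.
Proof.
move=> /(_ 0 isT); rewrite addn0 => -[ls Ei] [rt pt gt].
have [t' [rt' pt' gt']] := rinstr_run m ls pt gt; exists t'; rewrite Ei /= in pt' gt'.
by split=> //; apply: run_trans rt rt'.
Qed.

Lemma reaches_com c g g' : exec c g g' -> forall b t, placed b (compile b c) ->
  reaches b g t -> exists t', reaches (b + csize c) g' t'.
Proof.
elim=> {c g g'} [x y g|x y g|c1 c2 g1 g2 g3 _ IH1 _ IH2|y c g g0|
                 y c n g1 g2 g3 gn _ IH1 _ IH2] b t /=.
- by move=> pl /(reaches_instr pl); rewrite addn1.
- by move=> pl /(reaches_instr pl); rewrite addn1.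
- move=> /placed_cat[p1 p2] /(IH1 _ _ p1)[u]; rewrite size_compile in p2.
  by move=> /(IH2 _ _ p2); rewrite addnA.
- rewrite -cat1s => /placed_cat[pl _] /(reaches_instr pl) /=.
  by rewrite g0.
move=> pl; have := pl; rewrite -cat1s -cats1 => /placed_cat[p1 /placed_cat[p2 p3]].
rewrite addn1 in p2 p3; rewrite size_compile in p3.
move=> /(reaches_instr p1) [t1] /=; rewrite gn /= => /(IH1 _ _ p2)[t2].
move=> /(reaches_instr p3) [t3] /= r3; apply: (IH2 b t3) => //.
(* The jump back leaves [upd g2 y (g2 y)], which agrees with [g2] at each register. *)
case: r3 => rt pt gt; split=> // x; have := gt x.
by rewrite /upd; case: eqP => // ->.
Qed.

End Compilation.

(** * Partial recursive functions as programs *)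

Definition clear (x : nat) : com := CWhile x (CMov x x).

(** Registers from [fresh] on are scratch space, and [CMov fresh fresh] does nothing. In the
    minimisation, the body runs once before the loop, and each later run overwrites the decremented
    test register. *)
Fixpoint com_of_recf (n : nat) (f : recf n) (args : seq nat) (out fresh : nat) : com :=
  match f with
  | Zero _ => clear out
  | Succ => CInc out (nth 0 args 0)
  | Proj _ i => CMov out (nth 0 args i)
  | @Comp _ m f g =>
      CSeq (foldr (fun i => CSeq (com_of_recf (g i) args (fresh + i) (fresh + m)))
                  (CMov fresh fresh) (enum 'I_m))
           (com_of_recf f (iota fresh m) out (fresh + m))
  | PrimRec _ f g =>
      let cnt := fresh in let idx := fresh.+1 in let acc := fresh.+2 in let tmp := fresh.+3 in
      CSeq (CSeq (CSeq (CMov cnt (nth 0 args 0)) (clear idx))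
                 (com_of_recf f (behead args) acc fresh.+4))
        (CSeq (CWhile cnt (CSeq (com_of_recf g [:: idx, acc & behead args] tmp fresh.+4)
                                (CSeq (CMov acc tmp) (CInc idx idx))))
              (CMov out acc))
  | Mu _ f =>
      let idx := fresh in let tst := fresh.+1 in
      let body := com_of_recf f (idx :: args) tst fresh.+2 in
      CSeq (CSeq (clear idx) body)
        (CSeq (CWhile tst (CSeq (CInc idx idx) body)) (CMov out idx))
  end.

Definition computes (c : com) (g : nat -> nat) (out r fresh : nat) : Prop :=
  exists g', [/\ exec c g g', g' out = r & forall x, x < fresh -> x <> out -> g' x = g x].

Lemma upd_eq g x v : upd g x v x = v.
Proof. by rewrite /upd eqxx. Qed.

Lemma upd_neq g x v y : y <> x -> upd g x v y = g y.
Proof. by rewrite /upd; case: eqP. Qed.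

Lemma exec_clear x g :
  exists g', [/\ exec (clear x) g g', g' x = 0 & forall y, y <> x -> g' y = g y].
Proof.
have [n] := ubnP (g x); elim: n g => // n IHn g; case E: (g x) => [|k] lt.
  by exists g; split=> //; apply: exec_stop.
pose h := upd (upd g x k) x (upd g x k x).
have [|g' [e0 g'x g'y]] := IHn h; first by rewrite /h !upd_eq.
exists g'; split=> // [|y yx]; first exact: exec_loop E (exec_mov _ _ _) e0.
by rewrite g'y // /h !upd_neq.
Qed.

Lemma args_eq (g g' : nat -> nat) (args : seq nat) fresh v : all (gtn fresh) args ->
  (forall x, x < fresh -> g' x = g x) -> map g args = v -> map g' args = v.
Proof. by move=> /allP la E <-; apply/eq_in_map => x /la /E. Qed.

Section PrimIter.
Variables (n : nat) (f : recf n) (g : recf n.+2) (p : n.-tuple nat).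

Fixpoint prim_iter k r : Prop :=
  if k is k'.+1 then exists2 q, prim_iter k' q & sem g [tuple of k' :: q :: p] r
  else sem f p r.

End PrimIter.

Lemma sem_PrimRec n (f : recf n) (g : recf n.+2) v r :
  sem (PrimRec f g) v r <-> prim_iter f g [tuple of behead v] (thead v) r.
Proof. by []. Qed.

Lemma com_of_recf_correct n (f : recf n) (args : seq nat) out fresh (v : n.-tuple nat) r g :
  sem f v r -> all (gtn fresh) args -> out < fresh -> map g args = v ->
  computes (com_of_recf f args out fresh) g out r fresh.
Proof.
elim: f args out fresh v r g => [n0|||||].
- move=> args out fresh v r g /= -> _ lo _.
  by have [g' [e0 E1 E2]] := exec_clear out g; exists g'; split=> // x _; apply: E2.
- move=> args out fresh v r g /= -> la lo E.
  exists (upd g out (g (nth 0 args 0)).+1); split; first exact: exec_inc.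
    rewrite upd_eq; congr _.+1; have := size_map g args; rewrite E size_tuple.
    case: args E {la} => // a args E _; case/tupleP: v E => b v [-> _].
    by rewrite theadE.
  by move=> x _ /upd_neq.
- move=> n0 i args out fresh v r g /= -> la lo E.
  exists (upd g out (g (nth 0 args i))); split; first exact: exec_mov.
    rewrite upd_eq (tnth_nth 0) -E (nth_map 0) //.
    by have := size_map g args; rewrite E size_tuple => <-.
  by move=> x _ /upd_neq.
- move=> n0 m f IHf h IHh args out fresh v r g /= [w hw fw] la lo E.
  have [g1 [e1 E1 F1]] : exists g1, [/\
      exec (foldr (fun i => CSeq (com_of_recf (h i) args (fresh + i) (fresh + m)))
                  (CMov fresh fresh) (enum 'I_m)) g g1,
      forall x, x < fresh -> g1 x = g x & forall i : 'I_m, g1 (fresh + i) = tnth w i].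
    (* Generalised for induction to a duplicate-free list of indices; registers of indices outside
       the list keep their old value. *)
    have [] // : exists g1, [/\
      exec (foldr (fun i => CSeq (com_of_recf (h i) args (fresh + i) (fresh + m)))
                  (CMov fresh fresh) (enum 'I_m)) g g1,
      forall x, x < fresh -> g1 x = g x &
      forall i : 'I_m, g1 (fresh + i) = if i \in enum 'I_m then tnth w i else g (fresh + i)].
      elim: (enum 'I_m) (enum_uniq 'I_m) g E => [_|i s IHs /andP[nis us]] g E.
        exists (upd g fresh (g fresh)); split=> /=; first exact: exec_mov.
          by move=> x lx; rewrite upd_neq // => xf; rewrite xf ltnn in lx.
        by move=> i; rewrite /upd; case: eqP => // ->.
      have lfi : fresh + i < fresh + m by rewrite ltn_add2l.
      have la' : all (gtn (fresh + m)) args.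
        by apply: sub_all la => x /= lx; apply: ltn_addr.
      have [g1 [e1 E1 F1]] := IHh i args (fresh + i) (fresh + m) v _ g (hw i) la' lfi E.
      have G1 x : x < fresh -> g1 x = g x.
        move=> lx; apply: F1; first exact: ltn_addr.
        by move=> xi; move: lx; rewrite xi ltnNge leq_addr.
      have [g2 [e2 E2 F2]] := IHs us g1 (args_eq la G1 E).
      exists g2; split; first exact: exec_seq e1 e2.
        by move=> x lx; rewrite E2 // G1.
      move=> j; rewrite F2 inE; case: eqP => [->|nij] /=; first by rewrite (negPf nis) E1.
      case: ifP => // _; apply: F1; first by rewrite ltn_add2l.
      by move=> /addnI/val_inj.
    move=> g1 [e1 E1 F1]; exists g1; split=> // i.
    by rewrite F1 mem_enum.
  have [|||g2 [e2 E2 F2]] := IHf (iota fresh m) out (fresh + m) w r g1 fw.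
  - by apply/allP => x; rewrite mem_iota => /andP[].
  - exact: ltn_addr.
  - apply: (@eq_from_nth _ 0); rewrite size_map size_iota ?size_tuple // => i lim.
    rewrite (nth_map 0) ?size_iota // nth_iota //.
    by rewrite (F1 (Ordinal lim)) (tnth_nth 0).
  exists g2; split=> //; first exact: exec_seq e1 e2.
  by move=> x lx nx; rewrite F2 ?E1 //; apply: ltn_addr.
- move=> n0 f IHf h IHh args out fresh v r g /sem_PrimRec H la lo E.
  case: args E la => [|a args] E /= la; first by have := size_tuple v; rewrite -E.
  have Ek : thead v = g a by rewrite /thead (tnth_nth 0) -E.
  have Ep : map g args = [tuple of behead v] by rewrite /= -E.
  move: H Ep; rewrite Ek; set p := [tuple of behead v] => H Ep {Ek E}.
  case/andP: la => la las.
  have las4 : all (gtn fresh.+4) args by apply: sub_all las => x /=; lia.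
  set pre := CSeq (CSeq _ (clear _)) _; set W := CWhile _ _.
  (* Invariant after [j] rounds. As [exec_loop] builds an execution from its end, the past is kept
     as a continuation: a run of [W] from [gj] extends to a run of [pre] and [W] from [g]. *)
  have claim j q : prim_iter f h p j q -> j <= g a -> exists gj,
     [/\ gj fresh = g a - j, gj fresh.+1 = j, gj fresh.+2 = q,
         forall x, x < fresh -> gj x = g x & forall g3, exec W gj g3 -> exec (CSeq pre W) g g3].
    elim: j q => [|j IHj] q.
      move=> H0 _; pose g1 := upd g fresh (g a).
      have [g2 [e2 Z2 F2]] := exec_clear fresh.+1 g1.
      have G2 x : x < fresh -> g2 x = g x by move=> lx; rewrite F2 /g1 ?upd_neq //; lia.
      have [||g3 [e3 E3 F3]] := IHf args fresh.+2 fresh.+4 p q g2 H0 las4.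
      - lia.
      - exact: args_eq las G2 Ep.
      exists g3; split=> //.
      - by rewrite F3 ?F2 /g1 ?upd_eq ?subn0 //; lia.
      - by rewrite F3 //; lia.
      - by move=> x lx; rewrite F3 ?G2 //; lia.
      - move=> g4 e4; apply: exec_seq e4; apply: exec_seq e3; apply: exec_seq e2.
        exact: exec_mov.
    move=> [q0 /IHj IH sq] lj; have [|gj [C1 C2 C3 C4 C5]] := IH; first exact: ltnW.
    pose g1 := upd gj fresh (g a - j.+1).
    have G1 x : x < fresh -> g1 x = g x by move=> lx; rewrite /g1 upd_neq ?C4 //; lia.
    have [|||g2 [e2 E2 F2]] := IHh [:: fresh.+1, fresh.+2 & args] fresh.+3 fresh.+4 _ q g1 sq.
    - by rewrite /= las4; lia.
    - lia.
    - rewrite /= (args_eq las G1 Ep) /g1 !upd_neq ?C2 ?C3 //; lia.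
    pose g3 := upd g2 fresh.+2 (g2 fresh.+3); pose g4 := upd g3 fresh.+1 (g3 fresh.+1).+1.
    exists g4; split.
    - by rewrite /g4 /g3 !upd_neq ?F2 /g1 ?upd_eq //; lia.
    - rewrite /g4 upd_eq /g3 upd_neq ?F2 /g1 ?upd_neq ?C2 //; lia.
    - by rewrite /g4 upd_neq ?/g3 ?upd_eq //; lia.
    - by move=> x lx; rewrite /g4 /g3 !upd_neq ?F2 ?G1 //; lia.
    - move=> g5 e5; apply: C5; apply: (@exec_loop _ _ (g a - j.+1) _ g4) e5.
        by rewrite C1; lia.
      by apply: exec_seq e2 (exec_seq (exec_mov _ _ _) (exec_inc _ _ _)).
  have [gj [C1 C2 C3 C4 C5]] := claim _ _ H (leqnn _).
  have eW : exec (CSeq pre W) g gj by apply/C5/exec_stop; rewrite C1 subnn.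
  exists (upd gj out (gj fresh.+2)); split; last 2 first.
  - by rewrite upd_eq.
  - by move=> x lx nx; rewrite upd_neq ?C4.
  (* Inversion splits the run after [pre], so that the final move can be attached to [W]. *)
  - inversion eW; subst; apply: exec_seq; first by eassumption.
    by apply: exec_seq; [eassumption|apply: exec_mov].
- move=> n0 f IHf args out fresh v r g /= [H0 Hk] la lo E.
  have las2 : all (gtn fresh.+2) (fresh :: args).
    by rewrite /= leqnSn; apply: sub_all la => x /=; lia.
  set body := com_of_recf _ _ _ _; set pre := CSeq (clear _) _; set W := CWhile _ _.
  (* The same kind of invariant: the test register holds the value of [f] at [j], positive below [r]
     and zero at [r], so the loop stops with index [r]. *)
  have claim j : j <= r -> exists gj, [/\ gj fresh = j,
       (if j < r then exists q, gj fresh.+1 = q.+1 else gj fresh.+1 = 0),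
       forall x, x < fresh -> gj x = g x & forall g3, exec W gj g3 -> exec (CSeq pre W) g g3].
    have test q0 j0 g0 : j0 <= r -> g0 fresh = j0 -> (forall x, x < fresh -> g0 x = g x) ->
        sem f [tuple of j0 :: v] q0 -> exists g1, [/\ exec body g0 g1, g1 fresh = j0,
          g1 fresh.+1 = q0 & forall x, x < fresh -> g1 x = g x].
      move=> lj gj G0 sj.
      have [||g1 [e1 E1 F1]] := IHf (fresh :: args) fresh.+1 fresh.+2 _ q0 g0 sj las2.
      - lia.
      - by rewrite /= gj (args_eq la G0 E).
      exists g1; split=> // [|x lx]; first by rewrite F1 //; lia.
      by rewrite F1 ?G0 //; lia.
    have value j0 : j0 <= r -> exists q0, sem f [tuple of j0 :: v] q0 /\
        (if j0 < r then exists q, q0 = q.+1 else q0 = 0).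
      rewrite leq_eqVlt => /predU1P[->|lj]; first by exists 0; rewrite ltnn.
      by have [q sq] := Hk _ lj; exists q.+1; rewrite lj; split=> //; exists q.
    elim: j => [|j IHj] lj.
      have [q0 [s0 V0]] := value 0 lj.
      have [g1 [e1 Z1 F1]] := exec_clear fresh g.
      have G1 x : x < fresh -> g1 x = g x by move=> lx; apply: F1; lia.
      have [g2 [e2 E2 E3 F2]] := test q0 0 g1 lj Z1 G1 s0.
      exists g2; rewrite E3; split=> // g3 e3; apply: exec_seq e3; exact: exec_seq e1 e2.
    have [gj [C1 + C3 C4]] := IHj (ltnW lj); rewrite lj => -[q C2].
    have [q0 [s0 V0]] := value j.+1 lj.
    pose g1 := upd gj fresh.+1 q; pose g2 := upd g1 fresh (g1 fresh).+1.
    have [||g3 [e3 E3 E4 F3]] := test q0 j.+1 g2 lj _ _ s0.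
    - by rewrite /g2 upd_eq /g1 upd_neq ?C1 //; lia.
    - by move=> x lx; rewrite /g2 /g1 !upd_neq ?C3 //; lia.
    exists g3; rewrite E4; split=> // g4 e4; apply: C4.
    apply: exec_loop C2 _ e4; apply: exec_seq e3; exact: exec_inc.
  have [gj [C1 + C3 C4]] := claim r (leqnn r); rewrite ltnn => C2.
  have eW : exec (CSeq pre W) g gj by apply/C4/exec_stop.
  exists (upd gj out (gj fresh)); split; last 2 first.
  - by rewrite upd_eq.
  - by move=> x lx nx; rewrite upd_neq ?C3.
  - inversion eW; subst; apply: exec_seq; first by eassumption.
    by apply: exec_seq; [eassumption|apply: exec_mov].
Qed.

(** * Computability of the reduction *)

Definition computable n (F : n.-tuple nat -> nat) : Prop :=
  exists f : recf n, forall v, sem f v (F v).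

Definition computable1 (F : nat -> nat) := computable (fun v : 1.-tuple nat => F (thead v)).

Lemma computable_comp n m (H : m.-tuple nat -> nat) (F : 'I_m -> n.-tuple nat -> nat) :
  computable H -> (forall i, computable (F i)) ->
  computable (fun v => H [tuple F i v | i < m]).
Proof.
move=> [h hP] /choice[f fP]; exists (Comp h f) => v.
by exists [tuple F i v | i < m] => [i|]; rewrite ?tnth_mktuple; auto.
Qed.

Lemma computable_comp1 n (H : nat -> nat) (F : n.-tuple nat -> nat) :
  computable1 H -> computable F -> computable (fun v => H (F v)).
Proof.
move=> cH cF; have [f fP] := computable_comp cH (fun _ : 'I_1 => cF); exists f => v.
by have := fP v; rewrite /thead tnth_mktuple.
Qed.

Lemma computable_succ n (F : n.-tuple nat -> nat) :
  computable F -> computable (fun v => (F v).+1).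
Proof. by apply: computable_comp1; exists Succ. Qed.

Lemma computable_const n k : computable (fun _ : n.-tuple nat => k).
Proof. by elim: k => [|k]; [exists (Zero n)|apply: computable_succ]. Qed.

Lemma computable_proj n (i : 'I_n) : computable (fun v => tnth v i).
Proof. by exists (Proj i). Qed.

Lemma computable_rec n (F : n.-tuple nat -> nat) (G : n.+2.-tuple nat -> nat)
    (H : nat -> n.-tuple nat -> nat) :
  computable F -> computable G -> (forall p, H 0 p = F p) ->
  (forall k p, H k.+1 p = G [tuple of k :: H k p :: p]) ->
  computable (fun v : n.+1.-tuple nat => H (thead v) [tuple of behead v]).
Proof.
move=> [f fP] [g gP] H0 HS; exists (PrimRec f g) => v; apply/sem_PrimRec.
set p := [tuple of behead v]; elim: (thead v) => [|k IHk] /=; first by rewrite H0.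
by exists (H k p) => //; rewrite HS.
Qed.

Lemma computable_rec1 (c : nat) (G : 2.-tuple nat -> nat) (H : nat -> nat) :
  computable G -> H 0 = c -> (forall k, H k.+1 = G [tuple k; H k]) -> computable1 H.
Proof.
move=> cG H0 HS; apply: (computable_rec (F := fun=> c) (G := G) (H := fun k _ => H k)) => //.
  exact: computable_const.
by move=> k p; rewrite HS; congr G; apply: val_inj; rewrite /= (tuple0 p).
Qed.

Lemma computable_double n (F : n.-tuple nat -> nat) :
  computable F -> computable (fun v => (F v).*2).
Proof.
apply: computable_comp1; apply: (@computable_rec1 0 (fun v => (tnth v (inord 1)).+2)) => //.
  by do 2!apply: computable_succ; apply: computable_proj.
by move=> k; rewrite (tnth_nth 0) /= inordK.
Qed.

(** [CodeSeq.code] of [x :: s] is [2 ^ x] times the odd number [(CodeSeq.code s).*2.+1]; the power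
    is handled by iterated doubling. *)
Lemma computable_code_cons n (F : n.-tuple nat -> nat) (s : n.-tuple nat -> seq nat) :
  computable F -> computable (fun v => CodeSeq.code (s v)) ->
  computable (fun v => CodeSeq.code (F v :: s v)).
Proof.
move=> cF cs.
pose H k (p : 1.-tuple nat) := 2 ^ k * (thead p).*2.+1.
have cH : computable (fun v : 2.-tuple nat => H (thead v) [tuple of behead v]).
  apply: (computable_rec (F := fun p => (thead p).*2.+1)
      (G := fun v : 3.-tuple nat => (tnth v (inord 1)).*2)).
  - by apply/computable_succ/computable_double/computable_proj.
  - by apply/computable_double/computable_proj.
  - by move=> p; rewrite /H mul1n.
  - by move=> k p; rewrite /H (tnth_nth 0) /= inordK // expnS -mulnA mul2n.
have [f fP] := computable_comp cH (fun i : 'I_2 =>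
  if i == ord0 as b return computable (if b then F else (fun v => CodeSeq.code (s v)))
  then cF else cs).
exists f => v; have := fP v.
rewrite (_ : [tuple _ | i < 2] = [tuple F v; CodeSeq.code (s v)]) //.
by apply: eq_from_tnth => -[[|[|]] // ?]; rewrite tnth_mktuple.
Qed.

Definition computableF n (phi : n.-tuple nat -> tau_formula) : Prop :=
  computable (fun v => formula_code (phi v)).

Lemma computableF_const n phi : computableF (fun _ : n.-tuple nat => phi).
Proof. exact: computable_const. Qed.

Lemma computable_code3 n k (F G : n.-tuple nat -> nat) :
  computable F -> computable G -> computable (fun v => CodeSeq.code [:: k; F v; G v]).
Proof.
move=> cF cG; apply: computable_code_cons; first exact: computable_const.
apply: computable_code_cons => //; apply: computable_code_cons => //.
exact: computable_const.
Qed.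

Lemma computableF_and n (phi psi : n.-tuple nat -> tau_formula) :
  computableF phi -> computableF psi -> computableF (fun v => And (phi v) (psi v)).
Proof. exact: computable_code3. Qed.

Lemma computableF_or n (phi psi : n.-tuple nat -> tau_formula) :
  computableF phi -> computableF psi -> computableF (fun v => Or (phi v) (psi v)).
Proof. exact: computable_code3. Qed.

Lemma computableF_mark n (K : n.-tuple nat -> nat) u :
  computable K -> computableF (fun v => mark (K v) u).
Proof.
move=> cK; apply: (@computable_code3 _ 2 (fun v => (K v).+1) (fun=> u)).
  exact: computable_succ.
exact: computable_const.
Qed.

Lemma computableF_neg_mark n (K : n.-tuple nat -> nat) u :
  computable K -> computableF (fun v => neg (mark (K v) u)).
Proof.
move=> cK; apply: (@computable_code3 _ 3 (fun v => (K v).+1) (fun=> u)).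
  exact: computable_succ.
exact: computable_const.
Qed.

(** Only the marks of the two program counters vary; all other subformulas have constant codes. The
    input phase consists of such jumps. *)
Lemma computableF_jump n (K J : n.-tuple nat -> nat) d b : computable K -> computable J ->
  computableF (fun v => instrF (K v) (jump (Action d b (J v)))).
Proof.
move=> cK cJ.
have c4 (F : n.-tuple nat -> nat) : computable F -> computable (fun v => (F v).*2.+4).
  by move=> cF; do 4!apply: computable_succ; apply: computable_double.
pose A v := Action d b (J v).
have cA : computableF (fun v => actionF (A v)).
  apply: (@computableF_and _ (fun v => pcF (J v) 2)
    (fun=> And (tagF d.+1 2) (impF (ptrF 2 3) (moveF b)))); last exact: computableF_const.
  exact/computableF_mark/c4.
apply: (@computableF_or _ (fun=> startF 2) (fun v => impF (pcF (K v) 0)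
    (And (impF (prevF 2 3) (Eq 3 0)) (And (impF (tagF 0 1) (actionF (A v)))
         (Or (tagF 0 1) (actionF (A v))))))); first exact: computableF_const.
apply: (@computableF_or _ (fun v => neg (pcF (K v) 0)) (fun v =>
    And (impF (prevF 2 3) (Eq 3 0)) (And (impF (tagF 0 1) (actionF (A v)))
         (Or (tagF 0 1) (actionF (A v)))))); first exact/computableF_neg_mark/c4.
apply: (@computableF_and _ (fun=> impF (prevF 2 3) (Eq 3 0)) (fun v =>
    And (impF (tagF 0 1) (actionF (A v))) (Or (tagF 0 1) (actionF (A v))))).
  exact: computableF_const.
apply: (@computableF_and _ (fun v => impF (tagF 0 1) (actionF (A v)))
    (fun v => Or (tagF 0 1) (actionF (A v)))).
  by apply: (@computableF_or _ (fun=> neg (tagF 0 1)) (fun v => actionF (A v))) => //;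
    apply: computableF_const.
by apply: (@computableF_or _ (fun=> tagF 0 1) (fun v => actionF (A v))) => //;
  apply: computableF_const.
Qed.

Fixpoint inputF (m : nat) : tau_formula :=
  if m is j.+1 then And (inputF j) (instrF j.*2.+1 (input_instr j)) else topF.

Lemma computable_inputF : computable1 (fun m => formula_code (inputF m)).
Proof.
pose j (v : 2.-tuple nat) := tnth v ord0.
have [f fP] : computableF (fun v => instrF (j v).*2.+1 (input_instr (j v))).
  apply: computableF_jump; apply: computable_succ; apply: computable_double.
    exact: computable_proj.
  by apply: computable_succ; apply: computable_proj.
apply: (@computable_rec1 (formula_code topF) (fun v => CodeSeq.code
  [:: 5; tnth v (inord 1); formula_code (instrF (j v).*2.+1 (input_instr (j v)))])) => //.
  by apply: computable_code3; [apply: computable_proj|exists f].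
by move=> k; rewrite !(tnth_nth 0) /= inordK.
Qed.

Definition input_endF (m : nat) : tau_formula := And (inputF m) (instrF m.*2.+1 input_end).

(** The number [e] is inserted as if it were a formula code: for the code of [machineF rp] the
    result is the code of [runF rp e.*2]. The input is doubled because the input phase halves it. *)
Lemma computable_sentence : computable1 (fun e => CodeSeq.code [:: 7; 0; CodeSeq.code [:: 7; 1;
  CodeSeq.code [:: 7; 2; CodeSeq.code [:: 8; 3;
    CodeSeq.code [:: 5; e; formula_code (input_endF e.*2)]]]]]).
Proof.
do 4!(apply: computable_code3; first exact: computable_const).
apply: computable_code3; first exact: computable_proj.
have cd : computable (fun v : 1.-tuple nat => (thead v).*2).
  by apply: computable_double; apply: computable_proj.
apply: (@computableF_and _ (fun v => inputF (thead v).*2)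
  (fun v => instrF (thead v).*2.*2.+1 input_end)).
  exact: computable_comp1 computable_inputF cd.
apply: (@computableF_jump _ (fun v => (thead v).*2.*2.+1) (fun=> 0) 1 Stay).
  by apply: computable_succ; apply: computable_double.
exact: computable_const.
Qed.

(** * The reduction *)

Definition progF (rp : seq rinstr) : tau_formula :=
  allF (fun q => instrF q.*2 (block_code rp q)) (iota 0 (6 * size rp)).

(** The explicit 0, 1 and 2 belong to leaves, neutral nodes and the node closing the input phase;
    thus the list covers all inputs without depending on them. *)
Definition tags (rp : seq rinstr) : seq nat :=
  let qs := iota 0 (6 * size rp) in
  [:: 0; 1; 2] ++ [seq tested (block_code rp q) | q <- qs]
    ++ [seq (written (act_eq (block_code rp q))).+1 | q <- qs]
    ++ [seq (written (act_neq (block_code rp q))).+1 | q <- qs].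

(** The two halting states sit at the first two instruction positions behind the program, hence
    outside [pcs]. *)
Definition good_pc (rp : seq rinstr) := pc (size rp) 0.
Definition bad_pc (rp : seq rinstr) := pc (size rp).+1 0.

Definition machineF (rp : seq rinstr) : tau_formula :=
  coreF (And (frameF (tags rp) (bad_pc rp)) (progF rp)).

Definition runF (rp : seq rinstr) (m : nat) : tau_formula :=
  prefixed (And (machineF rp) (input_endF m)).

Lemma good_flat_input_endF m : good_flat (input_endF m).
Proof.
rewrite good_flat_And good_flat_instrF andbT; elim: m => //= m.
by rewrite good_flat_And good_flat_instrF => ->.
Qed.

Lemma good_flat_program rp : good_flat (And (frameF (tags rp) (bad_pc rp)) (progF rp)).
Proof.
rewrite good_flat_And good_flat_frameF good_flat_allF // => q.
exact: good_flat_instrF.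
Qed.

Lemma flat_quantifier_free (tau : vocabulary) (phi : formula tau) :
  flat phi -> quantifier_free phi.
Proof. by elim: phi => //= a IHa b IHb /andP[/IHa -> /IHb ->]. Qed.

Lemma sentence_prefixed (tau : vocabulary) (theta : formula tau) :
  all (gtn 4) (free_vars theta) -> sentence (prefixed theta).
Proof.
move=> l4; rewrite /sentence /= -!filter_predI; apply/eqP; rewrite -(negbK (_ == _)) -has_filter.
by apply/hasPn => x /(allP l4) /=; case: x => [|[|[|[|]]]].
Qed.

Lemma core_E3A phi psi : good_flat phi -> good_flat psi ->
  E3A_sentence (prefixed (And (coreF phi) psi)).
Proof.
move=> /andP[f1 v1] /andP[f2 v2]; split.
  by apply: sentence_prefixed; rewrite /= all_cat v1 v2.
exists 0, 1, 2, 3, (And (coreF phi) psi); split=> //=.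
by rewrite (flat_quantifier_free f1) (flat_quantifier_free f2).
Qed.

Lemma runF_E3A rp m : E3A_sentence (runF rp m).
Proof.
exact: core_E3A (good_flat_program rp) (good_flat_input_endF m).
Qed.

Lemma eval_inputF (M : structure tau_bin_un) (e : env M) m :
  eval e (inputF m) <-> forall j, j < m -> eval e (instrF j.*2.+1 (input_instr j)).
Proof.
elim: m => [|m IHm]; first by split.
split=> [[/IHm h1 h2] j|h]; last by split; [apply/IHm => j jm; apply: h; apply: ltnW|apply: h].
by rewrite ltnS leq_eqVlt => /predU1P[->|/h1].
Qed.

Lemma eval_run (M : structure tau_bin_un) (a b c d : M) rp m (e : env M := (a, b, c, d)) :
  eval e (And (And (frameF (tags rp) (bad_pc rp)) (progF rp)) (input_endF m)) <->
  frameM (tags rp) (bad_pc rp) a b c d /\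
  {in pcs rp m, forall n, instrM n (code rp m n) a b c d}.
Proof.
have -> : eval e (And (And (frameF (tags rp) (bad_pc rp)) (progF rp)) (input_endF m)) <->
  (eval e (frameF (tags rp) (bad_pc rp)) /\ eval e (progF rp)) /\
  (eval e (inputF m) /\ eval e (instrF m.*2.+1 input_end)) by [].
rewrite eval_frame eval_allF eval_inputF eval_instr; split.
  move=> [[hf hp] [hi he]]; split=> // n; rewrite mem_cat => /orP[] /mapP[q].
    by move=> /hp /eval_instr h ->; rewrite /code odd_double doubleK.
  rewrite mem_iota /= => qm ->; rewrite /code /= odd_double /= uphalf_double.
  case: ltnP => [/hi/eval_instr//|mq].
  by have -> : q = m by apply/eqP; rewrite eqn_leq mq -ltnS qm.
move=> [hf h]; split; split=> //.
- move=> q qs; apply/eval_instr; have := h q.*2.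
  by rewrite /code odd_double doubleK; apply; rewrite mem_cat map_f.
- move=> j jm; apply/eval_instr; have := h j.*2.+1.
  rewrite /code /= odd_double /= uphalf_double jm; apply.
  by rewrite mem_cat (map_f (fun q => q.*2.+1)) ?orbT // mem_iota /= ltnW.
- have := h m.*2.+1; rewrite /code /= odd_double /= uphalf_double ltnn; apply.
  by rewrite mem_cat (map_f (fun q => q.*2.+1)) ?orbT // mem_iota /=.
Qed.

(** In [runF] the input conjunct stays outside [coreF], so that [machineF rp] is a subformula with a
    fixed code; for the semantics it is moved inside. *)
Lemma holds_core_and (M : structure tau_bin_un) (X : team M) phi psi :
  holds X (And (coreF phi) psi) <-> holds X (coreF (And phi psi)).
Proof. by rewrite /coreF !holds_and; tauto. Qed.

Lemma tags_code rp m : {in pcs rp m, forall n, [/\ tested (code rp m n) \in tags rp,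
  (written (act_eq (code rp m n))).+1 \in tags rp &
  (written (act_neq (code rp m n))).+1 \in tags rp]}.
Proof.
move=> n; rewrite mem_cat => /orP[] /mapP[q qs ->].
  rewrite /code odd_double doubleK /tags !mem_cat; split.
  - by rewrite (map_f (fun q => tested (block_code rp q))) // !orbT.
  - by rewrite (map_f (fun q => (written (act_eq (block_code rp q))).+1)) // !orbT.
  - by rewrite (map_f (fun q => (written (act_neq (block_code rp q))).+1)) // !orbT.
by rewrite /code /= odd_double /=; case: ifP.
Qed.

(** * From the outcome of the run to satisfiability *)

Lemma bad_run_unsat rp m t : run (pcs rp m) (code rp m) start_tree t ->
  root_pc t = Some (bad_pc rp) -> ~ satisfiable (runF rp m).
Proof.
move=> rt bt [M /true_prefixed[T [T0 /holds_core_and hT]]].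
have gf : good_flat (And (And (frameF (tags rp) (bad_pc rp)) (progF rp)) (input_endF m)).
  by rewrite good_flat_And good_flat_program good_flat_input_endF.
(* The flat part is read off first, because [core_sound] needs [a <> b], which the frame
   provides. *)
have h a b c d : T a b c -> frameM (tags rp) (bad_pc rp) a b c d /\
    {in pcs rp m, forall n, instrM n (code rp m n) a b c d}.
  move=> Tabc; apply/eval_run; move: hT => [_ [_ [_ hT]]].
  by have /andP[f v] := gf; apply: ((holds_flat _ f v).1 hT).
have ne a b c : T a b c -> a <> b by move=> /h-/(_ a)[/frame_neq].
have [T1 T2 T3 _] := core_sound gf hT ne.
apply: (bad_unreachable (L := tags rp) _ _ (@tags_code rp m) T1 T2 T3 _ _ T0 rt bt) => //.
- by move=> a b c d /h-/(_ d)[].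
- by move=> a b c d /h-/(_ d)[].
Qed.

Lemma good_run_sat rp m t : run (pcs rp m) (code rp m) start_tree t ->
  root_pc t = Some (good_pc rp) -> finitely_satisfiable (runF rp m).
Proof.
move=> rt gt; pose M := history_model t; exists M; split; first exact: history_finite.
have out l : size rp <= l -> pc l 0 \notin pcs rp m.
  move=> ls; rewrite mem_cat negb_or; apply/andP; split; apply/mapP => -[q].
    rewrite mem_iota add0n /= => lq /double_inj; rewrite addn0 => E.
    by move: lq; rewrite -E ltn_mul2l /= ltnNge ls.
  by move=> _ /(congr1 odd) /=; rewrite !odd_double.
have g1 : good_pc rp <> 1 by move=> /(congr1 odd); rewrite odd_double.
have gb : good_pc rp <> bad_pc rp by move=> /double_inj; lia.
apply/true_prefixed; exists (@history_triple (pcs rp m) (code rp m) t); split.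
  have [b [c [h _]]] := triple_start rt (a := SeqSub (subtrees_refl t)) (final_chain gt).
  by exists (SeqSub (subtrees_refl t)), b, c.
apply/holds_core_and; apply: core_complete.
- by rewrite good_flat_And good_flat_program good_flat_input_endF.
- by move=> a b c /(triple_chain rt gt)/(triple_start rt)[b' [c' [h _]]]; exists b', c'.
- by move=> a b c [ac _ _]; apply: triple_start.
- by move=> a b c [ac _ _]; apply: (triple_step rt gt).
move=> [[[a b] c] d] abc; apply/eval_run; split.
  exact: (triple_frame _ rt gt (out _ (leqnSn _)) gb d abc).
exact: (triple_instr rt gt (out _ (leqnn _)) d abc).
Qed.

(** Register 1 holds the answer. The program has [(csize c).+1] instructions, so the targets are
    [good_pc] for 0 and [bad_pc] for a positive answer. *)
Definition test_program (c : com) : seq rinstr :=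
  compile 0 c ++ [:: RJz 1 1 (csize c).+1 (csize c).+2].

Lemma test_program_run c m g : exec c (upd (fun=> 0) 0 m./2) g ->
  exists t, [/\ run (pcs (test_program c) m) (code (test_program c) m) start_tree t,
    g 1 = 0 -> root_pc t = Some (good_pc (test_program c)) &
    g 1 = 1 -> root_pc t = Some (bad_pc (test_program c))].
Proof.
set rp := test_program c => ec.
have pl : placed rp 0 rp by move=> i.
have [p1 p2] := placed_cat pl; rewrite size_compile in p2.
have [t0 r0] := input_run rp m.
have [t1 r1] := reaches_com ec p1 r0.
have [t2 [r2 e2 _]] := reaches_instr p2 r1.
have sz : size rp = (csize c).+1 by rewrite size_cat size_compile addn1.
by exists t2; split=> // E; rewrite e2 /= E /good_pc /bad_pc sz.
Qed.

Theorem theorem22 :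
  ~ decidable_problem formula_code (@E3A_sentence tau_bin_un)
      (@satisfiable tau_bin_un) /\
  ~ decidable_problem formula_code (@E3A_sentence tau_bin_un)
      (@finitely_satisfiable tau_bin_un).
Proof.
(* Both problems lie between finite satisfiability and satisfiability, and the diagonal argument
   uses just these two inclusions. *)
suff main (P : tau_formula -> Prop) : (forall phi, P phi -> satisfiable phi) ->
    (forall phi, finitely_satisfiable phi -> P phi) ->
    ~ decidable_problem formula_code (@E3A_sentence tau_bin_un) P.
  split; apply: main => // phi [M]; first by case=> _ h; exists M.
  by case=> _ h; exists M.
move=> Psat satP [f fP]; have [h hP] := computable_sentence.
(* The supposed decider, run on the sentence computed from the input; below, register 0 is its
   input, 1 its output, and scratch space starts at 2. *)
pose D := Comp f (fun _ : 'I_1 => h).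
pose c := com_of_recf D [:: 0] 1 2; pose rp := test_program c.
have [e he] : exists e, sem h [tuple e] (formula_code (runF rp e.*2)).
  (* The diagonal choice: the program receives the code of its own machine formula. *)
  by exists (formula_code (machineF rp)); apply: hP.
set phi := runF _ _ in he.
have semD r : sem f [tuple formula_code phi] r -> sem D [tuple e] r.
  by move=> fr; exists [tuple formula_code phi] => // i; rewrite (ord1 i).
have runD r : sem f [tuple formula_code phi] r -> exists t,
    [/\ run (pcs rp e.*2) (code rp e.*2) start_tree t,
      r = 0 -> root_pc t = Some (good_pc rp) & r = 1 -> root_pc t = Some (bad_pc rp)].
  move=> /semD sr; have [//|//|//|g [eg E _]] :=
    com_of_recf_correct (args := [:: 0]) (out := 1) (fresh := 2)
      (g := upd (fun=> 0) 0 e.*2./2) sr.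
    by rewrite /= upd_eq doubleK.
  by have [t [rt t0 t1]] := test_program_run eg; exists t; rewrite -E.
(* A yes drives the run into the bad state, so there is no model; a no drives it into the good
   state, so there is a finite one. *)
case: (fP phi (runF_E3A _ _)) => -[Pphi /runD[t [rt t0 t1]]].
  exact: bad_run_unsat rt (t1 erefl) (Psat _ Pphi).
by apply/Pphi/satP/(good_run_sat rt)/t0.
Qed.
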